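(* Let $\mathbb{F}$ be a field, $0\ne q\in\mathbb{F}$ not a root of unity, $n\ge1$, $r\ge0$. Let $V_q$ be the vector representation of $U_q(\mathfrak{gl}_n)$, $\mathrm{Walk}(r)$ the set of walks of length $r$ on the Bratteli diagram, and $\mathfrak{c}_\pi\in V_q^{\otimes r}$ the vector attached to $\pi\in\mathrm{Walk}(r)$ (see the context). Then the set $\{\mathfrak{c}_\pi\mid\pi\in\mathrm{Walk}(r)\}$ is an orthogonal basis for the space of maximal vectors $\{v\in V_q^{\otimes r}\mid E_iv=0\text{ for }1\le i\le n-1\}$ in $V_q^{\otimes r}$, with respect to the symmetric bilinear form on $V_q^{\otimes r}$ for which the basis $\{v_{i_1}\otimes\cdots\otimes v_{i_r}\}$ is orthonormal.
   Context: Notation: $[m]=(q^m-q^{-m})/(q-q^{-1})$ for $m\in\mathbb{Z}$. **Algebra.** $U_q(\mathfrak{gl}_n)$ is the $\mathbb{F}$-algebra with generators $E_i,F_i$ ($1\le i\le n-1$), $K_i^{\pm1}$ ($1\le i\le n$) and relations: $K_iK_j=K_jK_i$, $K_iK_i^{-1}=1=K_i^{-1}K_i$; $E_iF_j-F_jE_i=\delta_{ij}\frac{\tilde K_i-\tilde K_i^{-1}}{q-q^{-1}}$ with $\tilde K_i=K_iK_{i+1}^{-1}$; $K_iE_j=q^{\delta_{i,j}-\delta_{i,j+1}}E_jK_i$, $K_iF_j=q^{-(\delta_{i,j}-\delta_{i,j+1})}F_jK_i$; $E_i^2E_j-(q+q^{-1})E_iE_jE_i+E_jE_i^2=0$ if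 $|i-j|=1$, $E_iE_j=E_jE_i$ if $|i-j|>1$; and the same two relations with every $E$ replaced by $F$. Tensor products are formed with the coproduct $\Delta(E_i)=E_i\otimes1+\tilde K_i\otimes E_i$, $\Delta(F_i)=F_i\otimes\tilde K_i^{-1}+1\otimes F_i$, $\Delta(K_i)=K_i\otimes K_i$. A vector $v$ has weight $\mu\in\mathbb{Z}^n$ if $K_iv=q^{\mu_i}v$ for all $i$. The vector representation $V_q$ has basis $v_1,\dots,v_n$ with $K_jv_i=q^{\delta_{ij}}v_i$, $F_iv_i=v_{i+1}$, $E_iv_{i+1}=v_i$, and $F_i$, $E_i$ kill all other basis vectors. A maximal vector of weight $\lambda$ is a nonzero vector of weight $\lambda$ killed by all $E_i$. **The elements $\Psi_j$.** Fix a partition $\lambda$, extended by zeros, and put $\alpha_i^\vee(\lambda)=\lambda_i-\lambda_{i+1}$. Set $c_1=0$, $c_m=\lambda_2-\lambda_{m+1}+m-1$ ($m\ge2$), $d_m=\lambda_1-\lambda_{m+1}+m-1$ ($m\ge1$). Define $\Psi_0=1$, $\Psi_1=F_1/[d_1]$ and $\Psi_m=\frac1{[d_m]}\big([c_m]F_1\Psi_{m-1}^+-[c_m-1]\Psi_{m-1}^+F_1\big)$ for $m\ge2$. Here the superscript $+$ replaces each $F_i$ by $F_{i+1}$ and each $\alpha_i$ by $\alpha_{i+1}$ (i.e. each $\lambda_i$ by $\lambda_{i+1}$), and $+(k)$ means shifting $k$ times. **The operators $\Phi_m$.** If $b$ is a maximal vector of weight $\lambda$ in a $U_q(\mathfrak{gl}_n)$-module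 $M$, then $\Phi_1(b)=v_1\otimes b$ and, for $2\le m\le n$ with $\alpha_{m-1}^\vee(\lambda)\ne0$, $\Phi_m(b)=\sum_{j=0}^{m-1}(-q^{-1})^j\,v_{m-j}\otimes\Psi_j^{+(m-j-1)}b\in V_q\otimes M$. The $\Psi$'s are formed with respect to the weight $\lambda$ of $b$. In this case $\Phi_m(b)$ is again a maximal vector, of weight $\lambda+\varepsilon_m$. **Walks.** The Bratteli diagram has as vertices at level $r$ the partitions of $r$ with at most $n$ parts, with an edge between vertices in successive levels that differ by one box. A walk of length $r$ is a sequence $\pi=(\emptyset=\pi^{(0)}\to\pi^{(1)}\to\cdots\to\pi^{(r)})$ in which each $\pi^{(j)}$ is obtained from $\pi^{(j-1)}$ by adding one box. If that box lies in row $k$ put $\Upsilon_j=\Phi_k$. Then $\mathfrak{c}_\pi=\Upsilon_r\Upsilon_{r-1}\cdots\Upsilon_1(1)\in V_q^{\otimes r}$, where $1$ spans $V_q^{\otimes0}=\mathbb{F}$. *)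

(* Defs.v *)
From HB Require Import structures.
From mathcomp Require Import all_boot all_order all_algebra.
From mathcomp Require Import ring zify.

Set Implicit Arguments.
Unset Strict Implicit.
Unset Printing Implicit Defensive.

Import GRing.Theory.

Local Open Scope ring_scope.

(* All indices of generators, basis vectors and parts are natural numbers     *)
(* starting at 1, as on paper; values outside the meaningful range are junk   *)
(* that is never used.                                                        *)

Definition qint (F : fieldType) (q : F) (m : int) : F :=
  (q ^ m - q ^ (- m)) / (q - q^-1).

Definition not_root_of_unity (F : fieldType) (q : F) : Prop :=
  forall m : nat, (0 < m)%N -> q ^+ m != 1.

(* -------------------------------------------------------------------------- *)
(* Representations of U_q(gl_n): since U_q(gl_n) is presented by generators   *)
(* and relations, a representation on V is a choice of operators E_i, F_i,    *)
(* K_i, K_i^-1 (the last one is [opKV]) satisfying [uq_relations].            *)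

Record uq_ops (F : fieldType) (V : vectType F) := UqOps {
  opE : nat -> 'End(V);
  opF : nat -> 'End(V);
  opK : nat -> 'End(V);
  opKV : nat -> 'End(V)
}.

Section Representations.
Variables (F : fieldType) (q : F) (n : nat) (V : vectType F).
Implicit Types (M : uq_ops V) (i j : nat).

Definition opKt M i : 'End(V) := (opK M i \o opKV M i.+1)%VF.
Definition opKtV M i : 'End(V) := (opK M i.+1 \o opKV M i)%VF.

Definition qserre (X Y : 'End(V)) : 'End(V) :=
  (X \o X \o Y)%VF - (q + q^-1) *: (X \o Y \o X)%VF + (Y \o X \o X)%VF.

Definition kronz i j : int := (i == j)%:Z.

Record uq_relations M : Prop := UqRelations {
  uq_KK i j : (1 <= i <= n)%N -> (1 <= j <= n)%N ->
    (opK M i \o opK M j)%VF = (opK M j \o opK M i)%VF;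
  uq_KKV i : (1 <= i <= n)%N -> (opK M i \o opKV M i)%VF = \1%VF;
  uq_KVK i : (1 <= i <= n)%N -> (opKV M i \o opK M i)%VF = \1%VF;
  uq_EF i j : (1 <= i < n)%N -> (1 <= j < n)%N ->
    (opE M i \o opF M j)%VF - (opF M j \o opE M i)%VF =
      (i == j)%:R *: ((q - q^-1)^-1 *: (opKt M i - opKtV M i));
  uq_KE i j : (1 <= i <= n)%N -> (1 <= j < n)%N ->
    (opK M i \o opE M j)%VF =
      q ^ (kronz i j - kronz i j.+1) *: (opE M j \o opK M i)%VF;
  uq_KF i j : (1 <= i <= n)%N -> (1 <= j < n)%N ->
    (opK M i \o opF M j)%VF =
      q ^ (- (kronz i j - kronz i j.+1)) *: (opF M j \o opK M i)%VF;
  uq_serreE i j : (1 <= i < n)%N -> (1 <= j < n)%N ->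
    (i.+1 == j) || (j.+1 == i) -> qserre (opE M i) (opE M j) = 0;
  uq_commE i j : (1 <= i < n)%N -> (1 <= j < n)%N ->
    (i.+1 < j)%N || (j.+1 < i)%N ->
    (opE M i \o opE M j)%VF = (opE M j \o opE M i)%VF;
  uq_serreF i j : (1 <= i < n)%N -> (1 <= j < n)%N ->
    (i.+1 == j) || (j.+1 == i) -> qserre (opF M i) (opF M j) = 0;
  uq_commF i j : (1 <= i < n)%N -> (1 <= j < n)%N ->
    (i.+1 < j)%N || (j.+1 < i)%N ->
    (opF M i \o opF M j)%VF = (opF M j \o opF M i)%VF
}.

Definition maximal_space M : {vspace V} :=
  (\bigcap_(1 <= i < n) lker (opE M i))%VS.

(* Evaluation of the elements Psi_m in End(V), the generators F_i acting as   *)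
(* [f i]; the superscript + replaces f i by f (i + 1) and lam i by            *)
(* lam (i + 1).                                                               *)
Definition Psi_c (lam : nat -> int) (m : nat) : int :=
  if m == 1%N then 0 else lam 2 - lam m.+1 + m%:Z - 1.

Definition Psi_d (lam : nat -> int) (m : nat) : int :=
  lam 1 - lam m.+1 + m%:Z - 1.

Fixpoint Psi (f : nat -> 'End(V)) (lam : nat -> int) (m : nat) : 'End(V) :=
  match m with
  | 0 => \1%VF
  | 1 => (qint q (Psi_d lam 1))^-1 *: f 1%N
  | m'.+1 =>
      let P := Psi (fun i => f i.+1) (fun i => lam i.+1) m' in
      (qint q (Psi_d lam m))^-1 *:
        (qint q (Psi_c lam m) *: (f 1%N \o P)%VF
         - qint q (Psi_c lam m - 1) *: (P \o f 1%N)%VF)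
  end.

Definition Psi_shift (k : nat) (f : nat -> 'End(V)) (lam : nat -> int)
    (m : nat) : 'End(V) :=
  Psi (fun i => f (i + k)%N) (fun i => lam (i + k)%N) m.

End Representations.

(* -------------------------------------------------------------------------- *)
(* Spaces with a distinguished basis indexed by a finite type I.              *)

Notation based F I := {ffun I -> F^o}.

Section Based.
Variables (F : fieldType).
Implicit Types (I J : finType).

Definition bvec I (i : I) : based F I := [ffun j => (j == i)%:R].

(* The linear map sending [bvec i] to [g i]. *)
Definition lin_ext I (W : vectType F) (g : I -> W) : 'Hom(based F I, W) :=
  linfun (fun x : based F I => \sum_i x i *: g i).

Definition bform I (x y : based F I) : F := \sum_i x i * y i.

(* F^I (x) F^J is realised as F^(I * J). *)
Definition tens I J (x : based F I) (y : based F J) :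
    based F (I * J)%type := [ffun p => x p.1 * y p.2].

Definition tens_op I J (A : 'End(based F I)) (B : 'End(based F J)) :
    'End(based F (I * J)%type) :=
  lin_ext (fun p => tens (A (bvec p.1)) (B (bvec p.2))).

End Based.

Section TensorRep.
Variables (F : fieldType) (q : F) (n : nat).

Definition unit_rep : uq_ops (based F unit) :=
  UqOps (fun=> 0) (fun=> 0) (fun=> \1%VF) (fun=> \1%VF).

Definition tens_rep (I J : finType)
    (M : uq_ops (based F I)) (N : uq_ops (based F J)) :
    uq_ops (based F (I * J)%type) :=
  UqOps (fun i => tens_op (opE M i) \1%VF + tens_op (opKt M i) (opE N i))
        (fun i => tens_op (opF M i) (opKtV N i) + tens_op \1%VF (opF N i))
        (fun i => tens_op (opK M i) (opK N i))
        (fun i => tens_op (opKV M i) (opKV N i)).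

(* v_a for 1 <= a <= n; it is 0 for the other values of a. *)
Definition vvec (a : nat) : based F 'I_n := [ffun k : 'I_n => (k.+1 == a)%:R].

(* The basis vector v_a corresponds to k : 'I_n with a = k + 1. *)
Definition vector_rep : uq_ops (based F 'I_n) :=
  UqOps (fun i => lin_ext (fun k : 'I_n => (k.+1 == i.+1)%:R *: vvec i))
        (fun i => lin_ext (fun k : 'I_n => (k.+1 == i)%:R *: vvec i.+1))
        (fun i => lin_ext (fun k : 'I_n => q ^+ (k.+1 == i) *: vvec k.+1))
        (fun i => lin_ext (fun k : 'I_n => q ^- (k.+1 == i) *: vvec k.+1)).

(* Indices (i_1, (i_2, ... (i_r, tt))) of the basis v_{i_1} (x) ... (x)       *)
(* v_{i_r} of the r-th tensor power of V_q.                                   *)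
Fixpoint word (r : nat) : finType :=
  if r is r'.+1 then ('I_n * word r')%type else unit.

Fixpoint tpower (r : nat) : uq_ops (based F (word r)) :=
  match r with
  | 0 => unit_rep
  | r'.+1 => tens_rep vector_rep (tpower r')
  end.

(* Phi_m b for b maximal of weight lam in M. For m = 1 the sum is             *)
(* vvec 1 (x) b.                                                              *)
Definition Phi (J : finType) (M : uq_ops (based F J)) (lam : nat -> int)
    (m : nat) (b : based F J) : based F ('I_n * J)%type :=
  \sum_(0 <= j < m)
    (- q^-1) ^+ j *: tens (vvec (m - j)) (Psi_shift q (m - j - 1) (opF M) lam j b).

End TensorRep.

(* -------------------------------------------------------------------------- *)
(* Walks. A partition with at most n parts is a weakly decreasing sequence    *)
(* of n naturals.                                                             *)

Definition is_partition (k : nat) (s : seq nat) : bool :=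
  sorted geq s && (sumn s == k).

Definition part (s : seq nat) (i : nat) : int := (nth 0%N s i.-1)%:Z.

Definition adds_box (n : nat) (mu nu : seq nat) : bool :=
  [exists k : 'I_n, nu == incr_nth mu k].

(* The row (numbered from 1) of the box added to mu to obtain nu. *)
Definition box_row (n : nat) (mu nu : seq nat) : nat :=
  (find (fun k => nu == incr_nth mu k) (iota 0 n)).+1.

Section Walks.
Variables n r : nat.

(* Parts are bounded by r, which is no restriction for partitions of j <= r   *)
(* and makes the type of walks finite.                                        *)
Definition shape_seq := (r.+1).-tuple (n.-tuple 'I_r.+1).

Definition wshape (p : shape_seq) (j : nat) : seq nat :=
  nth [::] [seq [seq val x | x <- val s] | s <- val p] j.

Definition is_walk (p : shape_seq) : bool :=
  [forall j : 'I_r.+1, is_partition j (wshape p j)]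
  && [forall j : 'I_r, adds_box n (wshape p j) (wshape p j.+1)].

Definition walk := {p : shape_seq | is_walk p}.

End Walks.

Section WalkVectors.
Variables (F : fieldType) (q : F) (n : nat).

Fixpoint shapes_vec (p : nat -> seq nat) (r : nat) : based F (word n r) :=
  match r return based F (word n r) with
  | 0 => bvec F tt
  | j.+1 => Phi q n (tpower q n j) (part (p j)) (box_row n (p j) (p j.+1))
              (shapes_vec p j)
  end.

Definition walk_vec (r : nat) (pi : walk n r) : based F (word n r) :=
  shapes_vec (wshape (val pi)) r.

End WalkVectors.

(* -------------------------------------------------------------------------- *)
(* The operators above do define representations (the main facts are          *)
(* tens_rep_relations, vector_rep_relations and tpower_relations), and        *)
(* [bform] is the form for which the basis of pure tensors is orthonormal     *)
(* (bform_bvec, bvec_tens, bvec_vvec).                                        *)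

Section Lemmas.
Variable F : fieldType.
Implicit Types I J : finType.

Lemma lin_ext_is_linear I (W : vectType F) (g : I -> W) :
  linear (fun x : based F I => \sum_i x i *: g i).
Proof.
move=> a x y; rewrite scaler_sumr -big_split /=; apply: eq_bigr => i _.
by rewrite !ffunE scalerDl scalerA.
Qed.

Lemma lin_extE I (W : vectType F) (g : I -> W) x :
  lin_ext g x = \sum_i x i *: g i.
Proof.
pose h : {linear based F I -> W} :=
  HB.pack (fun x : based F I => \sum_i x i *: g i)
    (GRing.isLinear.Build F _ W *:%R _ (lin_ext_is_linear g)).
exact: (lfunE h).
Qed.

Lemma based_sum I (x : based F I) : x = \sum_i x i *: bvec F i.
Proof.
apply/ffunP => j; rewrite sum_ffunE (bigD1 j) //= big1 => [|i /negPf ne].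
  by rewrite !ffunE eqxx addr0 [RHS]mulr1.
by rewrite !ffunE eq_sym ne; apply: mulr0.
Qed.

Lemma lin_ext_bvec I (W : vectType F) (g : I -> W) i : lin_ext g (bvec F i) = g i.
Proof.
rewrite lin_extE (bigD1 i) //= big1 => [|j /negPf ne].
  by rewrite !ffunE eqxx scale1r addr0.
by rewrite !ffunE ne scale0r.
Qed.

Lemma based_lfunP I (W : vectType F) (A B : 'Hom(based F I, W)) :
  (forall i, A (bvec F i) = B (bvec F i)) -> A = B.
Proof.
move=> eqAB; apply/lfunP => x; rewrite [x]based_sum !linear_sum.
by apply: eq_bigr => i _; rewrite !linearZ /= eqAB.
Qed.

Lemma bform_bvec I (i j : I) : bform (bvec F i) (bvec F j) = (i == j)%:R.
Proof.
rewrite /bform (bigD1 i) //= big1 => [|k /negPf ne].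
  by rewrite !ffunE eqxx mul1r addr0.
by rewrite !ffunE ne mul0r.
Qed.

Lemma bvec_tens I J (p : I * J) : bvec F p = tens (bvec F p.1) (bvec F p.2).
Proof.
apply/ffunP => -[i j]; case: p => a b; rewrite !ffunE /= xpair_eqE.
by case: eqP; case: eqP; rewrite /= ?mulr1 ?mulr0.
Qed.

Lemma tensDl I J (x x' : based F I) (y : based F J) :
  tens (x + x') y = tens x y + tens x' y.
Proof. by apply/ffunP => p; rewrite !ffunE; apply: mulrDl. Qed.
Lemma tensDr I J (x : based F I) (y y' : based F J) :
  tens x (y + y') = tens x y + tens x y'.
Proof. by apply/ffunP => p; rewrite !ffunE; apply: mulrDr. Qed.
Lemma tensZl I J a (x : based F I) (y : based F J) :
  tens (a *: x) y = a *: tens x y.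
Proof. by apply/ffunP => p; rewrite !ffunE; apply: (esym (mulrA _ _ _)). Qed.
Lemma tensZr I J a (x : based F I) (y : based F J) :
  tens x (a *: y) = a *: tens x y.
Proof. by apply/ffunP => p; rewrite !ffunE; apply: mulrCA. Qed.
Lemma tens_suml I J (K : finType) (f : K -> based F I) (y : based F J) :
  tens (\sum_k f k) y = \sum_k tens (f k) y.
Proof.
apply/ffunP => p; rewrite sum_ffunE ffunE sum_ffunE mulr_suml.
by apply: eq_bigr => k _; rewrite ffunE.
Qed.
Lemma tens_sumr I J (K : finType) (x : based F I) (f : K -> based F J) :
  tens x (\sum_k f k) = \sum_k tens x (f k).
Proof.
apply/ffunP => p; rewrite sum_ffunE ffunE sum_ffunE mulr_sumr.
by apply: eq_bigr => k _; rewrite ffunE.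
Qed.

Lemma tens_opE I J (A : 'End(based F I)) (B : 'End(based F J)) x y :
  tens_op A B (tens x y) = tens (A x) (B y).
Proof.
rewrite [x]based_sum [y]based_sum !linear_sum !tens_suml linear_sum /=.
apply: eq_bigr => i _; rewrite !tens_sumr linear_sum /=; apply: eq_bigr => j _.
rewrite !linearZ /= !tensZl !tensZr !linearZ /=.
rewrite scalerA mulrC -scalerA; congr (_ *: (_ *: _)).
by rewrite -(bvec_tens (i, j)) lin_ext_bvec.
Qed.

Lemma tens_lfunP I J (W : vectType F) (A B : 'Hom(based F (I * J)%type, W)) :
  (forall x y, A (tens x y) = B (tens x y)) -> A = B.
Proof. by move=> eqAB; apply: based_lfunP => p; rewrite bvec_tens. Qed.

Section Serre.
Variables (I : finType) (q : F).
Notation V := (based F I).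


Definition lin_fun (f : V -> V) :=
  (forall u v, f (u + v) = f u + f v) /\ (forall a u, f (a *: u) = a *: f u).

Lemma linear_lin (f : 'End(V)) : lin_fun f.
Proof. by split=> *; rewrite ?linearD ?linearZ. Qed.

Lemma serre_vec (x y x' y' : V -> V) (t : F) v : t != 0 -> q + q^-1 = t + t^-1 ->
  lin_fun x -> lin_fun y -> lin_fun x' -> lin_fun y' ->
  (forall v, y (x v) = t ^+ 2 *: x (y v)) ->
  (forall v, y (x' v) = t^-1 *: x' (y v)) ->
  (forall v, y' (x v) = t^-1 *: x (y' v)) ->
  x (x (x' v)) - (q + q^-1) *: x (x' (x v)) + x' (x (x v)) = 0 ->
  y (y (y' v)) - (q + q^-1) *: y (y' (y v)) + y' (y (y v)) = 0 ->
  x (x (x' v + y' v) + y (x' v + y' v)) + y (x (x' v + y' v) + y (x' v + y' v))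
  - (q + q^-1) *: (x (x' (x v + y v) + y' (x v + y v)) + y (x' (x v + y v) + y' (x v + y v)))
  + (x' (x (x v + y v) + y (x v + y v)) + y' (x (x v + y v) + y (x v + y v))) = 0.
Proof.
move=> t0 -> [xD xZ] [yD yZ] [x'D x'Z] [y'D y'Z] yxE yx'E y'xE.
rewrite !(xD, yD, x'D, y'D).
rewrite !(yxE, yx'E, y'xE, xZ, yZ, x'Z, y'Z).
move: (x (x (x' v))) (x (x (y' v))) (x (x' (y v))) (x (y (y' v))) (x' (y (y v))) (y (y (y' v))) (x (x' (x v))) (x (y' (y v))) (x' (x (y v))) (y (y' (y v))) (x' (x (x v))) (y' (y (y v))).
move=> a1 a2 a3 a4 a5 a6 a7 a8 a9 a10 a11 a12 e1 e2.
rewrite -[RHS](addr0 (0 : V)) -[X in _ = X + _]e1 -[X in _ = _ + X]e2.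
apply/ffunP => i; rewrite !ffunE /GRing.scale /=.
by field.
Qed.

Lemma qserreE (X Y : 'End(V)) v :
  qserre q X Y v = X (X (Y v)) - (q + q^-1) *: X (Y (X v)) + Y (X (X v)).
Proof.
by rewrite /qserre !add_lfunE opp_lfunE scale_lfunE !comp_lfunE.
Qed.

Lemma qserre_add (x y x' y' : 'End(V)) (t : F) : t != 0 -> q + q^-1 = t + t^-1 ->
  (y \o x)%VF = t ^+ 2 *: (x \o y)%VF ->
  (y' \o x')%VF = t ^+ 2 *: (x' \o y')%VF ->
  (y \o x')%VF = t^-1 *: (x' \o y)%VF ->
  (y' \o x)%VF = t^-1 *: (x \o y')%VF ->
  qserre q x x' = 0 -> qserre q y y' = 0 ->
  qserre q (x + y) (x' + y') = 0.
Proof.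
move=> t0 qt yx _ yx' y'x sx sy.
have yxE v : y (x v) = t ^+ 2 *: x (y v).
  by move/lfunP: yx => /(_ v); rewrite !lfun_simp.
have yx'E v : y (x' v) = t^-1 *: x' (y v).
  by move/lfunP: yx' => /(_ v); rewrite !lfun_simp.
have y'xE v : y' (x v) = t^-1 *: x (y' v).
  by move/lfunP: y'x => /(_ v); rewrite !lfun_simp.
move/lfunP: sx => sx; move/lfunP: sy => sy.
apply/lfunP => v; move: (sx v) (sy v); rewrite {sx sy} !qserreE zero_lfunE.
have addE (f g : 'End(V)) u : (f + g) u = f u + g u by rewrite lfun_simp.
rewrite !addE; exact: (serre_vec t0 qt (linear_lin x) (linear_lin y)
  (linear_lin x') (linear_lin y') yxE yx'E y'xE).
Qed.

End Serre.

Section Commutation.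
Variables (q : F) (n : nat) (V : vectType F) (M : uq_ops V).
Hypotheses (q0 : q != 0) (HM : uq_relations q n M).

Lemma comp_inv_comm (A B X : 'End(V)) (c : F) : c != 0 ->
  (A \o B)%VF = \1%VF -> (B \o A)%VF = \1%VF ->
  (A \o X)%VF = c *: (X \o A)%VF -> (B \o X)%VF = c^-1 *: (X \o B)%VF.
Proof.
move=> c0 AB BA AX; have -> : (X \o B)%VF = c *: (B \o X)%VF.
  transitivity (((B \o A) \o X) \o B)%VF; first by rewrite BA comp_lfun1l.
  rewrite -(comp_lfunA B A X) AX.
  by rewrite -comp_lfunZr -comp_lfunZl -!comp_lfunA AB comp_lfun1r.
by rewrite scalerA mulVf ?scale1r.
Qed.

Lemma comp_commZ (A B X : 'End(V)) (c d : F) :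
  (A \o X)%VF = c *: (X \o A)%VF -> (B \o X)%VF = d *: (X \o B)%VF ->
  ((A \o B) \o X)%VF = (c * d) *: (X \o (A \o B))%VF.
Proof.
move=> AX BX; rewrite -comp_lfunA BX -comp_lfunZr (comp_lfunA A X B) AX.
by rewrite -comp_lfunZl scalerA mulrC (comp_lfunA X A B).
Qed.

Definition cartan (i j : nat) : int :=
  kronz i j - kronz i j.+1 - (kronz i.+1 j - kronz i.+1 j.+1).

Lemma KtE i j : (1 <= i < n)%N -> (1 <= j < n)%N ->
  (opKt M i \o opE M j)%VF = q ^ cartan i j *: (opE M j \o opKt M i)%VF.
Proof.
move=> Hi Hj; rewrite /cartan expfzDr // -invr_expz.
apply: comp_commZ; first by apply: (uq_KE HM) => //; lia.
apply: (comp_inv_comm _ (uq_KKV HM _) (uq_KVK HM _)); rewrite ?expfz_neq0 //; try lia.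
by apply: (uq_KE HM) => //; lia.
Qed.

Lemma KtVE i j : (1 <= i < n)%N -> (1 <= j < n)%N ->
  (opKtV M i \o opE M j)%VF = q ^ (- cartan i j) *: (opE M j \o opKtV M i)%VF.
Proof.
move=> Hi Hj; have -> : - cartan i j = (kronz i.+1 j - kronz i.+1 j.+1) + - (kronz i j - kronz i j.+1) by rewrite /cartan /kronz; lia.
rewrite expfzDr // -[X in _ * X]invr_expz.
apply: comp_commZ; first by apply: (uq_KE HM) => //; lia.
apply: (comp_inv_comm _ (uq_KKV HM _) (uq_KVK HM _)); rewrite ?expfz_neq0 //; try lia.
by apply: (uq_KE HM) => //; lia.
Qed.

Lemma KtF i j : (1 <= i < n)%N -> (1 <= j < n)%N ->
  (opKt M i \o opF M j)%VF = q ^ (- cartan i j) *: (opF M j \o opKt M i)%VF.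
Proof.
move=> Hi Hj; have -> : - cartan i j = - (kronz i j - kronz i j.+1) + - (- (kronz i.+1 j - kronz i.+1 j.+1)) by rewrite /cartan /kronz; lia.
rewrite expfzDr // -[X in _ * X]invr_expz.
apply: comp_commZ; first by apply: (uq_KF HM) => //; lia.
apply: (comp_inv_comm _ (uq_KKV HM _) (uq_KVK HM _)); rewrite ?expfz_neq0 //; try lia.
by apply: (uq_KF HM) => //; lia.
Qed.

Lemma KtVF i j : (1 <= i < n)%N -> (1 <= j < n)%N ->
  (opKtV M i \o opF M j)%VF = q ^ cartan i j *: (opF M j \o opKtV M i)%VF.
Proof.
move=> Hi Hj; have -> : cartan i j = - (kronz i.+1 j - kronz i.+1 j.+1) + - (- (kronz i j - kronz i j.+1)) by rewrite /cartan /kronz; lia.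
rewrite expfzDr // -[X in _ * X]invr_expz.
apply: comp_commZ; first by apply: (uq_KF HM) => //; lia.
apply: (comp_inv_comm _ (uq_KKV HM _) (uq_KVK HM _)); rewrite ?expfz_neq0 //; try lia.
by apply: (uq_KF HM) => //; lia.
Qed.

Lemma comp_comm1 (A B X : 'End(V)) :
  (A \o B)%VF = \1%VF -> (B \o A)%VF = \1%VF ->
  (A \o X)%VF = (X \o A)%VF -> (B \o X)%VF = (X \o B)%VF.
Proof.
move=> AB BA AX; rewrite (@comp_inv_comm A B X 1) ?oner_eq0 ?scale1r //.
by rewrite invr1 scale1r.
Qed.

Lemma comp_commM (A B X : 'End(V)) :
  (A \o X)%VF = (X \o A)%VF -> (B \o X)%VF = (X \o B)%VF ->
  ((A \o B) \o X)%VF = (X \o (A \o B))%VF.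
Proof. by move=> AX BX; rewrite -comp_lfunA BX comp_lfunA AX comp_lfunA. Qed.

Lemma KVK_comm i j : (1 <= i <= n)%N -> (1 <= j <= n)%N ->
  (opKV M i \o opK M j)%VF = (opK M j \o opKV M i)%VF.
Proof.
by move=> Hi Hj; apply: (comp_comm1 (uq_KKV HM Hi) (uq_KVK HM Hi)); apply: (uq_KK HM).
Qed.

Lemma KVKV_comm i j : (1 <= i <= n)%N -> (1 <= j <= n)%N ->
  (opKV M i \o opKV M j)%VF = (opKV M j \o opKV M i)%VF.
Proof.
move=> Hi Hj; apply: (comp_comm1 (uq_KKV HM Hi) (uq_KVK HM Hi)).
by apply: esym; apply: KVK_comm.
Qed.

Lemma KtX_comm i X : (1 <= i < n)%N ->
  (forall k, (1 <= k <= n)%N -> (opK M k \o X)%VF = (X \o opK M k)%VF) ->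
  (opKt M i \o X)%VF = (X \o opKt M i)%VF.
Proof.
move=> Hi HX; apply: comp_commM; first by apply: HX; lia.
by apply: (@comp_comm1 (opK M i.+1)); [apply: (uq_KKV HM)|apply: (uq_KVK HM)|apply: HX]; lia.
Qed.
Lemma KtVX_comm i X : (1 <= i < n)%N ->
  (forall k, (1 <= k <= n)%N -> (opK M k \o X)%VF = (X \o opK M k)%VF) ->
  (opKtV M i \o X)%VF = (X \o opKtV M i)%VF.
Proof.
move=> Hi HX; apply: comp_commM; first by apply: HX; lia.
by apply: (@comp_comm1 (opK M i)); [apply: (uq_KKV HM)|apply: (uq_KVK HM)|apply: HX]; lia.
Qed.

Lemma KtKt i j : (1 <= i < n)%N -> (1 <= j < n)%N ->
  (opKt M i \o opKt M j)%VF = (opKt M j \o opKt M i)%VF.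
Proof.
move=> Hi Hj; apply: KtX_comm => // k Hk; apply: esym; apply: KtX_comm => // l Hl.
exact: (uq_KK HM).
Qed.
Lemma KtVKtV i j : (1 <= i < n)%N -> (1 <= j < n)%N ->
  (opKtV M i \o opKtV M j)%VF = (opKtV M j \o opKtV M i)%VF.
Proof.
move=> Hi Hj; apply: KtVX_comm => // k Hk; apply: esym; apply: KtVX_comm => // l Hl.
exact: (uq_KK HM).
Qed.

End Commutation.

Lemma lfunZP (V : vectType F) (A B C D : 'End(V)) (c : F) :
  (A \o B)%VF = c *: (C \o D)%VF -> forall v, A (B v) = c *: C (D v).
Proof. by move/lfunP => E v; move: (E v); rewrite !lfun_simp. Qed.
Lemma lfunCP (V : vectType F) (A B C D : 'End(V)) :
  (A \o B)%VF = (C \o D)%VF -> forall v, A (B v) = C (D v).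
Proof. by move/lfunP => E v; move: (E v); rewrite !lfun_simp. Qed.

Lemma cartan_refl i : cartan i i = 2.
Proof. by rewrite /cartan /kronz; lia. Qed.
Lemma cartan_adj i j : (i.+1 == j) || (j.+1 == i) -> cartan i j = -1.
Proof. by rewrite /cartan /kronz; lia. Qed.
Lemma cartan_far i j : (i.+1 < j)%N || (j.+1 < i)%N -> cartan i j = 0.
Proof. by rewrite /cartan /kronz; lia. Qed.
Lemma cartan_sym i j : cartan i j = cartan j i.
Proof. by rewrite /cartan /kronz; lia. Qed.

Lemma comp_tens_op I J (A C : 'End(based F I)) (B D : 'End(based F J)) :
  (tens_op A B \o tens_op C D)%VF = tens_op (A \o C)%VF (B \o D)%VF.
Proof. by apply: tens_lfunP => x y; rewrite !(lfun_simp, tens_opE). Qed.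

Lemma tens_op_comm I J (A C : 'End(based F I)) (B D : 'End(based F J)) (c d : F) :
  (A \o C)%VF = c *: (C \o A)%VF -> (B \o D)%VF = d *: (D \o B)%VF ->
  (tens_op A B \o tens_op C D)%VF = (c * d) *: (tens_op C D \o tens_op A B)%VF.
Proof.
move=> hAC BD; rewrite !comp_tens_op hAC BD; apply: tens_lfunP => x y.
by rewrite !(lfun_simp, tens_opE) tensZl tensZr scalerA.
Qed.

Lemma tens_serre I J (q : F) (A A' : 'End(based F I)) (B B' : 'End(based F J)) :
  (A \o A')%VF = (A' \o A)%VF ->
  qserre q (tens_op A B) (tens_op A' B') = tens_op (A \o A \o A')%VF (qserre q B B').
Proof.
move=> AA; apply: tens_lfunP => x y.
rewrite qserreE !tens_opE !comp_lfunE qserreE -!(lfunCP AA).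
by rewrite !tensDr -scaleN1r -[in RHS]scaleN1r !tensZr.
Qed.
Lemma tens_serrel I J (q : F) (A A' : 'End(based F I)) (B B' : 'End(based F J)) :
  (B \o B')%VF = (B' \o B)%VF ->
  qserre q (tens_op A B) (tens_op A' B') = tens_op (qserre q A A') (B \o B \o B')%VF.
Proof.
move=> AA; apply: tens_lfunP => x y.
rewrite qserreE !tens_opE !comp_lfunE qserreE -!(lfunCP AA).
by rewrite !tensDl -scaleN1r -[in RHS]scaleN1r !tensZl.
Qed.
Lemma tens_op0l I J (B : 'End(based F J)) : tens_op (0 : 'End(based F I)) B = 0.
Proof.
by apply: tens_lfunP => x y; rewrite tens_opE !lfunE /=; apply/ffunP=> p; rewrite !ffunE mul0r.
Qed.
Lemma tens_op0r I J (A : 'End(based F I)) : tens_op A (0 : 'End(based F J)) = 0.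
Proof.
by apply: tens_lfunP => x y; rewrite tens_opE !lfunE /=; apply/ffunP=> p; rewrite !ffunE mulr0.
Qed.

Lemma comm_add (V : vectType F) (x y x' y' : 'End(V)) :
  (x \o x')%VF = (x' \o x)%VF -> (y \o y')%VF = (y' \o y)%VF ->
  (x \o y')%VF = (y' \o x)%VF -> (y \o x')%VF = (x' \o y)%VF ->
  ((x + y) \o (x' + y'))%VF = ((x' + y') \o (x + y))%VF.
Proof.
move=> h1 h2 h3 h4; rewrite !comp_lfunDl !comp_lfunDr h1 h2 h3 h4.
by rewrite addrACA.
Qed.


Lemma tens_EF (V : zmodType) (a b c d a' d' : V) :
  a + c + (b + d) - (a' + b + (c + d')) = a - a' + (d - d').
Proof.
have kA (x y z : V) : x + y - (x + z) = y - z by rewrite opprD addrACA subrr add0r.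
rewrite (addrACA a c) opprD (addrACA (a + b) (c + d)) kA.
by rewrite (addrC a b) (addrC a' b) kA.
Qed.

Lemma tens_opBl I J (A A' : 'End(based F I)) (B : 'End(based F J)) :
  tens_op (A - A') B = tens_op A B - tens_op A' B.
Proof.
apply: tens_lfunP => x y; rewrite add_lfunE opp_lfunE !tens_opE add_lfunE opp_lfunE.
by rewrite tensDl -scaleN1r tensZl scaleN1r.
Qed.
Lemma tens_opBr I J (A : 'End(based F I)) (B B' : 'End(based F J)) :
  tens_op A (B - B') = tens_op A B - tens_op A B'.
Proof.
apply: tens_lfunP => x y; rewrite add_lfunE opp_lfunE !tens_opE add_lfunE opp_lfunE.
by rewrite tensDr -scaleN1r tensZr scaleN1r.
Qed.
Lemma tens_opZl I J a (A : 'End(based F I)) (B : 'End(based F J)) :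
  tens_op (a *: A) B = a *: tens_op A B.
Proof. by apply: tens_lfunP => x y; rewrite scale_lfunE !tens_opE scale_lfunE tensZl. Qed.
Lemma tens_opZr I J a (A : 'End(based F I)) (B : 'End(based F J)) :
  tens_op A (a *: B) = a *: tens_op A B.
Proof. by apply: tens_lfunP => x y; rewrite scale_lfunE !tens_opE scale_lfunE tensZr. Qed.

Section Tens.
Variables (q : F) (n : nat) (I J : finType).
Variables (M : uq_ops (based F I)) (N : uq_ops (based F J)).
Hypotheses (q0 : q != 0) (HM : uq_relations q n M) (HN : uq_relations q n N).

Lemma tens_rep_relations : uq_relations q n (tens_rep M N).
Proof.
have idl (K : finType) (X : 'End(based F K)) : (\1 \o X)%VF = 1 *: (X \o \1)%VF.
  by rewrite comp_lfun1l comp_lfun1r scale1r.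
have idr (K : finType) (X : 'End(based F K)) : (X \o \1)%VF = 1 *: (\1 \o X)%VF.
  by rewrite comp_lfun1l comp_lfun1r scale1r.
have KKi (K : finType) (P : uq_ops (based F K)) i j : uq_relations q n P -> (1 <= i < n)%N -> (1 <= j < n)%N ->
    (opKt P i \o opKt P j)%VF = 1 *: (opKt P j \o opKt P i)%VF.
  move=> HP Hi Hj; rewrite scale1r. by apply: (KtKt q0 HP).
have KVKVi (K : finType) (P : uq_ops (based F K)) i j : uq_relations q n P -> (1 <= i < n)%N -> (1 <= j < n)%N ->
    (opKtV P i \o opKtV P j)%VF = 1 *: (opKtV P j \o opKtV P i)%VF.
  by move=> HP Hi Hj; rewrite scale1r; apply: (KtVKtV q0 HP).
have flip (K : finType) (X Y : 'End(based F K)) c d : c * d = 1 -> (X \o Y)%VF = c *: (Y \o X)%VF -> (Y \o X)%VF = d *: (X \o Y)%VF.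
  by move=> cd ->; rewrite scalerA mulrC cd scale1r.
have zz k : q ^ k * q ^ (- k) = 1 by rewrite -expfzDr // subrr.
have zz' k : q ^ (- k) * q ^ k = 1 by rewrite -expfzDr // addNr.
split=> [i j Hi Hj|i Hi|i Hi|i j Hi Hj|i j Hi Hj|i j Hi Hj|i j Hi Hj A|i j Hi Hj A|i j Hi Hj A|i j Hi Hj A] /=.
- by rewrite !comp_tens_op (uq_KK HM) // (uq_KK HN).
- rewrite comp_tens_op (uq_KKV HM) // (uq_KKV HN) //.
  by apply: tens_lfunP => x y; rewrite tens_opE !lfunE.
- rewrite comp_tens_op (uq_KVK HM) // (uq_KVK HN) //.
  by apply: tens_lfunP => x y; rewrite tens_opE !lfunE.
- have cc : tens_op (opKt M i \o opF M j)%VF (opE N i \o opKtV N j)%VF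
           = tens_op (opF M j \o opKt M i)%VF (opKtV N j \o opE N i)%VF.
    rewrite (KtF q0 HM Hi Hj) (flip _ _ _ _ _ (zz' _) (KtVE q0 HN Hj Hi)).
    apply: tens_lfunP => u v; rewrite !(lfun_simp, tens_opE) tensZl tensZr scalerA.
    by rewrite (cartan_sym j) zz' scale1r.
  rewrite !comp_lfunDl !comp_lfunDr !comp_tens_op.
  rewrite !comp_lfun1l !comp_lfun1r cc.
  set b := tens_op (opE M i) (opF N j).
  set c := tens_op (_ \o _)%VF (_ \o opE N i)%VF.
  rewrite tens_EF.
  have -> : opKt (tens_rep M N) i = tens_op (opKt M i) (opKt N i).
    by rewrite /opKt /= comp_tens_op.
  have -> : opKtV (tens_rep M N) i = tens_op (opKtV M i) (opKtV N i).
    by rewrite /opKtV /= comp_tens_op.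
  have e1 := uq_EF HM Hi Hj. have e2 := uq_EF HN Hi Hj.
  rewrite -tens_opBl -tens_opBr e1 e2.
  case: (i =P j) => [<-|_]; last by rewrite !scale0r tens_op0l tens_op0r addr0.
  rewrite !scale1r tens_opZl tens_opZr -scalerDr tens_opBl tens_opBr.
  by congr (_ *: _); rewrite [LHS]addrC addrA subrK.
- have h1 := uq_KE HM Hi Hj. have h2 := uq_KE HN Hi Hj.
  rewrite comp_lfunDl comp_lfunDr scalerDr; congr (_ + _).
    by rewrite (tens_op_comm h1 (idr _ _)) mulr1.
  have h3 : (opK M i \o opKt M j)%VF = 1 *: (opKt M j \o opK M i)%VF.
    rewrite scale1r; apply: esym; apply: (KtX_comm q0 HM) => // k Hk; exact: (uq_KK HM).
  by rewrite (tens_op_comm h3 h2) mul1r.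
- have h1 := uq_KF HM Hi Hj. have h2 := uq_KF HN Hi Hj.
  rewrite comp_lfunDl comp_lfunDr scalerDr; congr (_ + _); last first.
    by rewrite (tens_op_comm (idr _ _) h2) mul1r.
  have h3 : (opK N i \o opKtV N j)%VF = 1 *: (opKtV N j \o opK N i)%VF.
    rewrite scale1r; apply: esym; apply: (KtVX_comm q0 HN) => // k Hk; exact: (uq_KK HN).
  by rewrite (tens_op_comm h1 h3) mulr1.
- apply: (@qserre_add _ _ _ _ _ _ q) => //.
  + by rewrite (tens_op_comm (KtE q0 HM Hi Hi) (idr _ _)) cartan_refl mulr1.
  + by rewrite (tens_op_comm (KtE q0 HM Hj Hj) (idr _ _)) cartan_refl mulr1.
  + by rewrite (tens_op_comm (KtE q0 HM Hi Hj) (idr _ _)) cartan_adj // mulr1.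
  + by rewrite (tens_op_comm (KtE q0 HM Hj Hi) (idr _ _)) cartan_sym cartan_adj // mulr1.
  + by rewrite (tens_serrel _ _ _ erefl) (uq_serreE HM) // tens_op0l.
  + rewrite (tens_serre _ _ _ (KtKt q0 HM Hi Hj));
    by rewrite (uq_serreE HN) // tens_op0r.
- apply: comm_add.
  + by rewrite !comp_tens_op (uq_commE HM Hi Hj).
  + by rewrite !comp_tens_op (uq_commE HN Hi Hj) // (KtKt q0 HM Hi Hj).
  + by rewrite !comp_tens_op !comp_lfun1r !comp_lfun1l (KtE q0 HM) // cartan_sym cartan_far // scale1r.
  + by rewrite !comp_tens_op !comp_lfun1r !comp_lfun1l (KtE q0 HM) // cartan_far // scale1r.
- apply: (@qserre_add _ _ _ _ _ _ q^-1) => //.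
  + by rewrite invr_eq0.
  + by rewrite invrK addrC.
  + rewrite (tens_op_comm (idl _ _) (flip _ _ _ _ _ (zz _) (KtVF q0 HN Hi Hi))).
    by rewrite cartan_refl mul1r exprVn.
  + rewrite (tens_op_comm (idl _ _) (flip _ _ _ _ _ (zz _) (KtVF q0 HN Hj Hj))).
    by rewrite cartan_refl mul1r exprVn.
  + rewrite (tens_op_comm (idl _ _) (flip _ _ _ _ _ (zz _) (KtVF q0 HN Hj Hi))).
    by rewrite cartan_sym cartan_adj // mul1r invrK.
  + rewrite (tens_op_comm (idl _ _) (flip _ _ _ _ _ (zz _) (KtVF q0 HN Hi Hj))).
    by rewrite cartan_adj // mul1r invrK.
  + rewrite (tens_serrel _ _ _ (KtVKtV q0 HN Hi Hj));
    by rewrite (uq_serreF HM) // tens_op0l.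
  + by rewrite (tens_serre _ _ _ erefl) (uq_serreF HN) // tens_op0r.
- apply: comm_add.
  + by rewrite !comp_tens_op (uq_commF HM Hi Hj) // (KtVKtV q0 HN Hi Hj).
  + by rewrite !comp_tens_op (uq_commF HN Hi Hj).
  + by rewrite !comp_tens_op !comp_lfun1r !comp_lfun1l (KtVF q0 HN) // cartan_far // scale1r.
  + by rewrite !comp_tens_op !comp_lfun1r !comp_lfun1l (KtVF q0 HN) // cartan_sym cartan_far // scale1r.
Qed.
End Tens.


Lemma unit_rep_relations (q : F) n : uq_relations q n (unit_rep F).
Proof.
split=> * /=; rewrite /qserre /opKt /opKtV /= ?comp_lfun1l ?comp_lfun1r;
  by do ?rewrite ?(comp_lfun0l, comp_lfun0r, scaler0, subrr, addr0).
Qed.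

Section Vector.
Variables (q : F) (n : nat).
Hypotheses (q0 : q != 0) (q1 : not_root_of_unity q).
Notation R := (vector_rep q n).
Notation v := (vvec F n).

Lemma bvec_vvec (k : 'I_n) : bvec F k = v k.+1.
Proof. by apply/ffunP => j; rewrite !ffunE. Qed.

Lemma vvecP a : (exists k : 'I_n, v a = bvec F k /\ a = k.+1) \/ (v a = 0 /\ ~~ (0 < a <= n)%N).
Proof.
case: (boolP (0 < a <= n)%N) => [Ha|Ha]; [left|right].
  have lt : (a.-1 < n)%N by lia.
  by exists (Ordinal lt); split; [rewrite bvec_vvec; congr v; rewrite /=; lia|rewrite /=; lia].
split=> //; apply/ffunP => k; rewrite !ffunE.
by case: eqP => //; have := ltn_ord k; lia.
Qed.

Lemma vE i a : (1 <= i < n)%N -> opE R i (v a) = if a == i.+1 then v i else 0.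
Proof.
move=> Hi; case: (vvecP a) => [[k [-> ->]]|[-> Ha]].
  by rewrite lin_ext_bvec; case: eqP; rewrite ?scale1r ?scale0r.
by rewrite linear0; case: eqP => // e; lia.
Qed.
Lemma vF i a : (1 <= i < n)%N -> opF R i (v a) = if a == i then v i.+1 else 0.
Proof.
move=> Hi; case: (vvecP a) => [[k [-> ->]]|[-> Ha]].
  by rewrite lin_ext_bvec; case: eqP; rewrite ?scale1r ?scale0r.
by rewrite linear0; case: eqP => // e; lia.
Qed.
Lemma vK i a : opK R i (v a) = q ^ (kronz a i) *: v a.
Proof.
case: (vvecP a) => [[k [-> ->]]|[-> Ha]]; last by rewrite linear0 scaler0.
by rewrite lin_ext_bvec -bvec_vvec.
Qed.
Lemma vKV i a : opKV R i (v a) = q ^ (- kronz a i) *: v a.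
Proof.
case: (vvecP a) => [[k [-> ->]]|[-> Ha]]; last by rewrite linear0 scaler0.
by rewrite lin_ext_bvec -bvec_vvec -invr_expz.
Qed.

Lemma vvec_lfunP (A B : 'End(based F 'I_n)) :
  (forall a, (1 <= a <= n)%N -> A (v a) = B (v a)) -> A = B.
Proof.
by move=> AB; apply: based_lfunP => k; rewrite bvec_vvec AB //=.
Qed.

Lemma vector_rep_relations : uq_relations q n R.
Proof.
have lin0 (A : 'End(based F 'I_n)) : A 0 = 0 by rewrite linear0.
have linZ (A : 'End(based F 'I_n)) a x : A (a *: x) = a *: A x by rewrite linearZ.
have vKt i a : opKt R i (v a) = q ^ (kronz a i - kronz a i.+1) *: v a.
  by rewrite /opKt comp_lfunE vKV linZ vK scalerA addrC expfzDr.
have vKtV i a : opKtV R i (v a) = q ^ (kronz a i.+1 - kronz a i) *: v a.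
  by rewrite /opKtV comp_lfunE vKV linZ vK scalerA addrC expfzDr.
have qq : q - q^-1 != 0.
  rewrite subr_eq0; apply/eqP => e; have /eqP[] := q1 (isT : (0 < 2)%N).
  by rewrite expr2 {2}e mulfV.
split=> [i j Hi Hj|i Hi|i Hi|i j Hi Hj|i j Hi Hj|i j Hi Hj|i j Hi Hj A|i j Hi Hj A|i j Hi Hj A|i j Hi Hj A];
  apply: vvec_lfunP => a Ha.
- by rewrite !comp_lfunE !vK !linZ !vK !scalerA mulrC.
- by rewrite !comp_lfunE vKV linZ vK scalerA -expfzDr // addNr scale1r id_lfunE.
- by rewrite !comp_lfunE vK linZ vKV scalerA -expfzDr // subrr scale1r id_lfunE.
- rewrite add_lfunE opp_lfunE !comp_lfunE vE // vF // !scale_lfunE add_lfunE opp_lfunE vKt vKtV.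
  rewrite -scalerBl !scalerA.
  have -> : opE R i (if a == j then v j.+1 else 0) = ((a == j) && (i == j))%:R *: v a.
    case: eqP => [->|_]; rewrite ?lin0 ?scale0r // vE // eqSS eq_sym.
    by case: eqP => [->|_]; rewrite ?scale1r ?scale0r.
  have -> : opF R j (if a == i.+1 then v i else 0) = ((a == i.+1) && (i == j))%:R *: v a.
    case: eqP => [->|_]; rewrite ?lin0 ?scale0r // vF //.
    by case: eqP => [->|_]; rewrite ?scale1r ?scale0r.
  rewrite -scalerBl; congr (_ *: _).
  case: (i =P j) => [<-|_]; last by rewrite !andbF subrr !mul0r.
  rewrite !andbT mul1r /kronz.
  case: (a =P i) => [->|ai]; first by rewrite (_ : (i == i.+1) = false) ?subr0 ?sub0r ?mulVf //; lia.
  case: (a =P i.+1) => [_|_]; last by rewrite !subrr mulr0.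
  rewrite [X in _ * X](_ : _ = - (q - q^-1)); last by rewrite opprB.
  by rewrite mulrN mulVf // sub0r.
- rewrite scale_lfunE !comp_lfunE vE // vK linZ vE //.
  case: eqP => [->|_]; last by rewrite lin0 !scaler0.
  rewrite vK scalerA -expfzDr //; congr (q ^ _ *: _).
  by rewrite /kronz; lia.
- rewrite scale_lfunE !comp_lfunE vF // vK linZ vF //.
  case: eqP => [->|_]; last by rewrite lin0 !scaler0.
  rewrite vK scalerA -expfzDr //; congr (q ^ _ *: _).
  by rewrite /kronz; lia.
- rewrite qserreE zero_lfunE !vE //.
  do 2! (case: eqP => ?; rewrite ?lin0 ?vE //); do ?(case: eqP => ?; rewrite ?lin0 ?vE //);
   rewrite ?scaler0 ?subr0 ?addr0 ?add0r //; lia.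
- rewrite !comp_lfunE !vE //.
  by do 2! (case: eqP => ?; rewrite ?lin0 ?vE //); do ?(case: eqP => ?; rewrite ?lin0 ?vE //); lia.
- rewrite qserreE zero_lfunE !vF //.
  do 2! (case: eqP => ?; rewrite ?lin0 ?vF //); do ?(case: eqP => ?; rewrite ?lin0 ?vF //);
   rewrite ?scaler0 ?subr0 ?addr0 ?add0r //; lia.
- rewrite !comp_lfunE !vF //.
  by do 2! (case: eqP => ?; rewrite ?lin0 ?vF //); do ?(case: eqP => ?; rewrite ?lin0 ?vF //); lia.
Qed.

Lemma tpower_relations r : uq_relations q n (tpower q n r).
Proof.
elim: r => [|r IH] /=; first exact: unit_rep_relations.
exact: tens_rep_relations q0 vector_rep_relations IH.
Qed.
End Vector.
End Lemmas.

(* Main.v *)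
From HB Require Import structures.
Require Import Defs.
From mathcomp Require Import all_boot all_order all_algebra.
From mathcomp Require Import ring zify.

(* Orthogonality: the form is contravariant, the adjoint of F_i being
   q Kt_i^-1 E_i. If b and b' are orthogonal maximal vectors, moving the F_i
   across the form shows that the submodules which they generate are
   orthogonal, hence so are Phi_k b and Phi_l b'. If b = b' and k <> l, the
   weights of Phi_k b and Phi_l b differ.

   Independence: the component of Phi_m b along v_m is b, and its components
   along v_k, k > m, are 0.

   Spanning: if x = sum_k v_k (x) x_k is maximal and m is the last index with
   x_m <> 0, then x_m is maximal and x_m = - q E_(m-1) x_(m-1). By sl_2-theory
   a maximal vector in the image of E_(m-1) has no component of weight lam with
   lam_(m-1) = lam_m, so that x_m is a combination of vectors b for which
   Phi_m b is defined; subtract the same combination of the Phi_m b. *)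

Set Implicit Arguments.
Unset Strict Implicit.
Unset Printing Implicit Defensive.

Import Order.TTheory GRing.Theory Num.Theory.
Local Open Scope ring_scope.

(** * Quantum integers and weights *)

Section QuantumIntegers.
Variables (F : fieldType) (q : F).
Hypotheses (q_neq0 : q != 0) (q_generic : not_root_of_unity q).

Lemma expfz_generic_inj (a b : int) : q ^ a = q ^ b -> a = b.
Proof.
have pos (c : int) : 0 < c -> q ^ c = 1 -> False.
  by case: c => // c c_gt0 qc; have /eqP := q_generic (m := c) c_gt0.
have diff (c d : int) : q ^ c = q ^ d -> q ^ (c - d) = 1.
  by move=> qcd; rewrite expfzDr // qcd -expfzDr // subrr.
move=> qab; case: (ltrgtP a b) => // lt_ab.
  by case: (pos (b - a)); [rewrite subr_gt0|apply: diff].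
by case: (pos (a - b)); [rewrite subr_gt0|apply: diff].
Qed.

Lemma subrV_generic_neq0 : q - q^-1 != 0.
Proof.
rewrite subr_eq0; apply/eqP => qV.
by have /eqP := @expfz_generic_inj 1 (-1) qV.
Qed.

Lemma qint_eq0 (m : int) : (qint q m == 0) = (m == 0).
Proof.
rewrite /qint mulf_eq0 invr_eq0 (negPf subrV_generic_neq0) orbF subr_eq0.
apply/eqP/eqP => [/expfz_generic_inj|->]; [lia|by rewrite oppr0].
Qed.

Lemma qintN (m : int) : qint q (- m) = - qint q m.
Proof. by rewrite /qint opprK -mulNr opprB. Qed.

(** The quantum form of c(a + 1) - (c - 1)a = a + c. It evaluates the bracket in the recursion for
    Psi to [d_m], and it drives the induction on powers of F in [sl2_weightN2_eq0]. *)
Lemma qint_mulD (a c : int) :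
  qint q c * qint q (a + 1) - qint q (c - 1) * qint q a = qint q (a + c).
Proof.
have nz (m : int) : q ^ m != 0 by rewrite expfz_neq0.
rewrite /qint !opprD ?opprB !expfzDr // -!invr_expz !expr1z ?invrK.
move: (q ^ a) (q ^ c) (nz a) (nz c) subrV_generic_neq0 => x y x0 y0 qq.
field.
rewrite q_neq0 x0 y0 ?andbT /=.
have -> : q ^+ 2 - 1 = q * (q - q^-1) by rewrite mulrBr mulfV.
by rewrite mulf_neq0.
Qed.

End QuantumIntegers.

Section Weights.
Variables (F : fieldType) (q : F) (n : nat) (V : vectType F) (M : uq_ops V).
Hypotheses (q_neq0 : q != 0) (q_generic : not_root_of_unity q).
Hypothesis (HM : uq_relations q n M).

Definition has_weight (lam : nat -> int) (x : V) :=
  forall i, (1 <= i <= n)%N -> opK M i x = q ^ lam i *: x.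

Lemma eq_has_weight (lam mu : nat -> int) x :
  (forall i, (1 <= i <= n)%N -> lam i = mu i) ->
  has_weight lam x -> has_weight mu x.
Proof. by move=> eq_lm wx i Hi; rewrite -eq_lm // wx. Qed.

Lemma has_weightD lam x y :
  has_weight lam x -> has_weight lam y -> has_weight lam (x + y).
Proof. by move=> wx wy i Hi; rewrite linearD /= wx // wy // scalerDr. Qed.

Lemma has_weightZ lam a x : has_weight lam x -> has_weight lam (a *: x).
Proof. by move=> wx i Hi; rewrite linearZ /= wx // !scalerA mulrC. Qed.

Lemma opKV_weight lam x i : has_weight lam x -> (1 <= i <= n)%N ->
  opKV M i x = q ^ (- lam i) *: x.
Proof.
move=> wx Hi; have /lfunP/(_ x) := uq_KVK HM Hi.
rewrite comp_lfunE id_lfunE wx // linearZ /= => /(congr1 ( *:%R (q ^ (- lam i)))).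
by rewrite scalerA -expfzDr // addNr scale1r.
Qed.

Lemma opKt_weight lam x i : has_weight lam x -> (1 <= i < n)%N ->
  opKt M i x = q ^ (lam i - lam i.+1) *: x.
Proof.
move=> wx Hi; rewrite /opKt comp_lfunE (opKV_weight wx); last by lia.
by rewrite linearZ /= wx ?scalerA -?expfzDr //; [congr (q ^ _ *: _)|]; lia.
Qed.

Lemma opKtV_weight lam x i : has_weight lam x -> (1 <= i < n)%N ->
  opKtV M i x = q ^ (lam i.+1 - lam i) *: x.
Proof.
move=> wx Hi; rewrite /opKtV comp_lfunE (opKV_weight wx); last by lia.
by rewrite linearZ /= wx ?scalerA -?expfzDr //; [congr (q ^ _ *: _)|]; lia.
Qed.

Lemma opE_opF i j x : (1 <= i < n)%N -> (1 <= j < n)%N ->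
  opE M i (opF M j x) = opF M j (opE M i x) +
    (i == j)%:R *: ((q - q^-1)^-1 *: (opKt M i x - opKtV M i x)).
Proof.
move=> Hi Hj; have /lfunP/(_ x) := uq_EF HM Hi Hj.
by rewrite !(add_lfunE, opp_lfunE, comp_lfunE, scale_lfunE) => <-; rewrite addrC subrK.
Qed.

Lemma opKtVK i : (1 <= i < n)%N -> (opKtV M i \o opKt M i)%VF = \1%VF.
Proof.
move=> Hi; rewrite /opKtV /opKt comp_lfunA -(comp_lfunA (opK M i.+1)) (uq_KVK HM); last by lia.
by rewrite comp_lfun1r (uq_KKV HM) //; lia.
Qed.

(** Asks only for an eigenvector of Kt_i, because the sl_2-argument decomposes vectors by Kt_i alone
    and not by full weights. *)
Lemma opE_opF_eigen i (s : int) x : (1 <= i < n)%N -> opKt M i x = q ^ s *: x ->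
  opE M i (opF M i x) = opF M i (opE M i x) + qint q s *: x.
Proof.
move=> Hi Ktx; rewrite opE_opF // eqxx scale1r Ktx.
have -> : opKtV M i x = q ^ (- s) *: x.
  have /lfunP/(_ x) := opKtVK Hi; rewrite comp_lfunE id_lfunE Ktx linearZ /=.
  by move/(congr1 ( *:%R (q ^ (- s)))); rewrite scalerA -expfzDr // addNr scale1r.
by rewrite -scalerBl scalerA /qint mulrC.
Qed.

Lemma opE_opF_weight lam i j x : (1 <= i < n)%N -> (1 <= j < n)%N ->
  has_weight lam x ->
  opE M i (opF M j x) = opF M j (opE M i x) +
    ((i == j)%:R * qint q (lam i - lam i.+1)) *: x.
Proof.
move=> Hi Hj wx; rewrite opE_opF // (opKt_weight wx) // (opKtV_weight wx) //.
by rewrite -scalerBl !scalerA /qint opprB mulrAC mulrA.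
Qed.

Lemma has_weight_opF lam i x : (1 <= i < n)%N -> has_weight lam x ->
  has_weight (fun k => lam k - kronz k i + kronz k i.+1) (opF M i x).
Proof.
move=> Hi wx k Hk; rewrite (lfunZP (uq_KF HM Hk Hi)) wx // linearZ /= scalerA.
by rewrite -expfzDr //; congr (q ^ _ *: _); lia.
Qed.

End Weights.

(** * The elements Psi *)

Section PsiRecursion.
Variables (F : fieldType) (q : F) (V : vectType F).
Implicit Types (f : nat -> 'End(V)) (lam : nat -> int).

Lemma PsiSS f lam m (P := Psi q (fun i => f i.+1) (fun i => lam i.+1) m.+1) :
  Psi q f lam m.+2 = (qint q (Psi_d lam m.+2))^-1 *:
    (qint q (Psi_c lam m.+2) *: (f 1%N \o P)%VF
     - qint q (Psi_c lam m.+2 - 1) *: (P \o f 1%N)%VF).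
Proof. by []. Qed.

Lemma eq_Psi f f' lam lam' m :
  (forall i, (0 < i)%N -> f i = f' i) -> (forall i, (0 < i)%N -> lam i = lam' i) ->
  Psi q f lam m = Psi q f' lam' m.
Proof.
elim: m f f' lam lam' => // -[|m] IH f f' lam lam' eq_f eq_lam.
  by rewrite /= /Psi_d !eq_lam // eq_f.
have E := IH (fun i => f i.+1) (fun i => f' i.+1) (fun i => lam i.+1)
  (fun i => lam' i.+1) (fun i _ => eq_f i.+1 isT) (fun i _ => eq_lam i.+1 isT).
by rewrite !PsiSS E /Psi_d /Psi_c /= !eq_lam // eq_f.
Qed.

Lemma eq_Psi_shift k f lam lam' m :
  (forall i, (k < i)%N -> lam i = lam' i) ->
  Psi_shift q k f lam m = Psi_shift q k f lam' m.
Proof. by move=> eq_lam; apply: eq_Psi => // i i0; apply: eq_lam; lia. Qed.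

Hypotheses (q_neq0 : q != 0) (q_generic : not_root_of_unity q).

Lemma Psi_shift0 k f lam : Psi_shift q k f lam 0 = \1%VF.
Proof. by []. Qed.

(** For m = 0 the bracket is [0] - [-1] = 1, which gives back Psi_1 = F_1/[d_1]. Inductions can
    therefore start at Psi_0 = 1. *)
Lemma Psi_shiftS k f lam m x :
  Psi_shift q k f lam m.+1 x =
    (qint q (lam k.+1 - lam (k + m).+2 + m%:Z))^-1 *:
      (qint q (lam k.+2 - lam (k + m).+2 + m%:Z) *:
         f k.+1 (Psi_shift q k.+1 f lam m x)
       - qint q (lam k.+2 - lam (k + m).+2 + m%:Z - 1) *:
           Psi_shift q k.+1 f lam m (f k.+1 x)).
Proof.
case: m => [|m].
  rewrite Psi_shift0 !id_lfunE addn0 /Psi_shift /= /Psi_d scale_lfunE.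
  rewrite -scalerBl !add1n add2n.
  rewrite [X in _ *: (X *: _)](_ : _ = 1) ?scale1r; last first.
    rewrite subrr addr0 /qint oppr0 subrr mul0r sub0r.
    rewrite sub0r opprK expr1z -[q ^ (-1)]invr_expz expr1z -mulNr opprB mulfV //.
    exact: subrV_generic_neq0.
  by congr ((qint q _)^-1 *: _); lia.
have -> : Psi_shift q k.+1 f lam m.+1 =
   Psi q (fun i => f (i.+1 + k)%N) (fun i => lam (i.+1 + k)%N) m.+1.
  by apply: eq_Psi => i _; rewrite addnS.
rewrite {1}/Psi_shift PsiSS /Psi_d /Psi_c /=.
rewrite scale_lfunE add_lfunE opp_lfunE !scale_lfunE !comp_lfunE.
rewrite add1n add2n (_ : m.+3 + k = (k + m.+1).+2)%N; last by lia.
by congr ((qint q _)^-1 *: (qint q _ *: _ - qint q _ *: _)); lia.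
Qed.

(** Psi_m shifted by k is a noncommutative polynomial in f_(k+1), ..., f_(k+m). *)
Lemma Psi_shift_comm k f lam m (X : 'End(V)) x :
  (forall j y, (k < j <= k + m)%N -> X (f j y) = f j (X y)) ->
  X (Psi_shift q k f lam m x) = Psi_shift q k f lam m (X x).
Proof.
elim: m k x => [|m IH] k x Xf; first by rewrite Psi_shift0 !id_lfunE.
have IHk y : X (Psi_shift q k.+1 f lam m y) = Psi_shift q k.+1 f lam m (X y).
  by apply: IH => j z Hj; apply: Xf; lia.
rewrite !Psi_shiftS linearZ linearB /= !linearZ /= Xf ?IHk ?Xf //; lia.
Qed.

(** The entry lam_(k+1) occurs only in the outermost denominator: the numerators start from
    lam_(k+2), and the inner Psi is shifted once more. *)
Lemma Psi_shift_rescale k f lam lam' m x :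
  (forall i, (k.+1 < i)%N -> lam i = lam' i) ->
  lam k.+1 - lam (k + m).+2 + m%:Z != 0 -> lam' k.+1 - lam' (k + m).+2 + m%:Z != 0 ->
  qint q (lam k.+1 - lam (k + m).+2 + m%:Z) *: Psi_shift q k f lam m.+1 x =
  qint q (lam' k.+1 - lam' (k + m).+2 + m%:Z) *: Psi_shift q k f lam' m.+1 x.
Proof.
move=> eq_lam d_neq0 d'_neq0; rewrite !Psi_shiftS !scalerA !mulfV ?qint_eq0 //.
by rewrite (eq_Psi_shift f (k := k.+1) m eq_lam) !eq_lam //; lia.
Qed.

End PsiRecursion.

Section PsiMaximal.
Variables (F : fieldType) (q : F) (n : nat) (V : vectType F) (M : uq_ops V).
Hypotheses (q_neq0 : q != 0) (q_generic : not_root_of_unity q).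
Hypothesis (HM : uq_relations q n M).

(** Each monomial contains F_(k+1), ..., F_(k+m) once, so the weight changes telescope. The
    parameter lam' of Psi is kept apart from the weight of b because the recursion also applies Psi
    to F_(k+1) b. *)
Lemma has_weight_Psi k lam lam' m b : (k + m < n)%N -> has_weight q n M lam b ->
  has_weight q n M (fun i => lam i - kronz i k.+1 + kronz i (k + m).+1)
    (Psi_shift q k (opF M) lam' m b).
Proof.
elim: m k lam b => [|m IH] k lam b km wb.
  rewrite Psi_shift0 id_lfunE addn0; apply: eq_has_weight wb => i _.
  by rewrite subrK.
have Hk : (1 <= k.+1 < n)%N by lia.
have kS : (k.+1 + m < n)%N by lia.
rewrite Psi_shiftS // -scaleNr; apply/has_weightZ/has_weightD; apply: has_weightZ.
  apply: eq_has_weight (has_weight_opF q_neq0 HM Hk (IH _ _ _ kS wb)) => i _.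
  by rewrite /= addSnnS; lia.
apply: eq_has_weight (IH _ _ _ kS (has_weight_opF q_neq0 HM Hk wb)) => i _.
by rewrite /= addSnnS; lia.
Qed.

(* [Psi] formed at [lam] applied to [F_(k+1) b] is, up to the factor of
   [Psi_shift_rescale], [Psi] formed at the weight of [F_(k+1) b], so that the
   induction hypothesis applies to [F_(k+1) b] as well. *)
Lemma opE_Psi k lam m b i : (k + m < n)%N -> (k < i < n)%N ->
  has_weight q n M lam b ->
  (forall j, (k < j < n)%N -> opE M j b = 0) ->
  (forall j, (k < j <= k + m)%N -> lam (k + m).+1 < lam j) ->
  opE M i (Psi_shift q k (opF M) lam m b) =
    if (0 < m)%N && (i == k.+1) then Psi_shift q k.+1 (opF M) lam m.-1 b else 0.
Proof.
elim: m k lam b i => [|m IH] k lam b i km Hi wb Eb lam_gt.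
  by rewrite Psi_shift0 id_lfunE Eb.
have Hk : (1 <= k.+1 < n)%N by lia.
have Hi' : (1 <= i < n)%N by lia.
have kS : (k.+1 + m < n)%N by lia.
have d_neq0 : qint q (lam k.+1 - lam (k + m).+2 + m%:Z) != 0.
  have := lam_gt k.+1; rewrite addnS qint_eq0 //; lia.
have EP : (forall y, opE M i (opF M k.+1 y) = opF M k.+1 (opE M i y)) ->
  opE M i (Psi_shift q k (opF M) lam m.+1 b) = (qint q (lam k.+1 - lam (k + m).+2 + m%:Z))^-1 *:
      (qint q (lam k.+2 - lam (k + m).+2 + m%:Z) *:
         opF M k.+1 (opE M i (Psi_shift q k.+1 (opF M) lam m b))
       - qint q (lam k.+2 - lam (k + m).+2 + m%:Z - 1) *:
           opE M i (Psi_shift q k.+1 (opF M) lam m (opF M k.+1 b))).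
  by move=> EF; rewrite Psi_shiftS // linearZ linearB /= !linearZ /= EF.
rewrite /=; case: eqP => [ik|/eqP ik]; last first.
  have EF y : opE M i (opF M k.+1 y) = opF M k.+1 (opE M i y).
    by rewrite (opE_opF HM) // (negPf ik) scale0r addr0.
  rewrite EP //.
  case: m IH km kS d_neq0 lam_gt {EP} => [|m] IH km kS d_neq0 lam_gt.
    by rewrite Psi_shift0 !id_lfunE EF Eb ?(linear0, scaler0, subrr).
  have wFb := has_weight_opF q_neq0 HM Hk wb.
  set lam' := (fun j => _) in wFb.
  have EFb j : (k.+1 < j < n)%N -> opE M j (opF M k.+1 b) = 0.
    move=> Hj; rewrite (opE_opF HM) ?Eb ?linear0 ?add0r; try lia.
    by rewrite (_ : (j == k.+1) = false) ?scale0r //; lia.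
  have lamE j : (k.+2 < j)%N -> lam j = lam' j by rewrite /lam' /kronz; lia.
  have lam'2 : lam' k.+2 = lam k.+2 + 1 by rewrite /lam' /kronz; lia.
  have kk : (k + m.+1).+2 = (k.+1 + m).+2 by lia.
  have lt2 : lam (k.+1 + m).+2 < lam k.+2 by rewrite -kk -addnS; apply: lam_gt; lia.
  have resc := Psi_shift_rescale q_neq0 q_generic (opF M) (k := k.+1) (m := m) (opF M k.+1 b) lamE.
  rewrite -(lamE (k.+1 + m).+2) in resc; last by lia.
  rewrite kk.
  (* [c - 1] is the denominator of the inner Psi at lam. Since lam'_(k+2) = lam_(k+2) + 1, its
     denominator at lam' is [c], so after rescaling both terms carry the factor [c]. *)
  have -> : lam k.+2 - lam (k.+1 + m).+2 + m.+1%:Z - 1 =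
            lam k.+2 - lam (k.+1 + m).+2 + m%:Z by lia.
  rewrite -[X in _ *: (_ - X)]linearZ resc //=; try lia.
  have -> : lam' k.+2 - lam (k.+1 + m).+2 + m%:Z =
            lam k.+2 - lam (k.+1 + m).+2 + m.+1%:Z by lia.
  rewrite linearZ /= -scalerBr.
  rewrite (IH k.+1 lam) //; try lia; last first.
  - by move=> j Hj; rewrite addnS -kk -addnS; apply: lam_gt; lia.
  - by move=> j Hj; apply: Eb; lia.
  rewrite (IH k.+1 lam') //; try lia; last first.
    move=> j Hj; rewrite addnS -lamE; last by lia.
    have : lam (k.+1 + m).+2 < lam j by rewrite -kk -addnS; apply: lam_gt; lia.
    by move=> lt; apply: lt_le_trans lt _; rewrite /lam' /kronz; lia.
  (* For i = k + 2 what remains is the commutator of F_(k+1) with a Psi in F_(k+3) and later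
     generators, which is 0. *)
  case: ifP => _; last by rewrite linear0 subr0 !scaler0.
  rewrite -(eq_Psi_shift _ _ _ (k := k.+2) lamE).
  rewrite (Psi_shift_comm q_neq0 q_generic) ?subrr ?scaler0 //.
  by move=> j y Hj; apply: (lfunCP (uq_commF HM _ _ _)); lia.
rewrite {EP}ik {i Hi Hi' ik}.
(* For i = k + 1, E_i commutes with the inner Psi and kills b, so only its commutators with F_(k+1)
   survive. With a = lam_(k+1) - lam_(k+2) they give [a + 1] in the first term and [a] in the
   second. *)
have PE y : opE M k.+1 (Psi_shift q k.+1 (opF M) lam m y) =
            Psi_shift q k.+1 (opF M) lam m (opE M k.+1 y).
  apply: Psi_shift_comm => // j z Hj; rewrite (opE_opF HM) //; last by lia.
  by rewrite (_ : (k.+1 == j) = false) ?scale0r ?addr0 //; lia.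
have E0 : opE M k.+1 b = 0 by apply: Eb; lia.
rewrite Psi_shiftS // linearZ linearB /= !linearZ /= PE.
rewrite [opE M _ (opF M _ b)](opE_opF_weight q_neq0 HM Hk Hk wb).
rewrite (opE_opF_weight q_neq0 HM Hk Hk (has_weight_Psi lam kS wb)).
have A0 (A : 'End(V)) : A 0 = 0 by rewrite linear0.
have AZ (A : 'End(V)) a y : A (a *: y) = a *: A y by rewrite linearZ.
rewrite PE E0 !A0 !add0r AZ eqxx !mul1r scalerN !scalerA -scalerBl scalerA.
rewrite [X in X *: _](_ : _ = 1) ?scale1r //.
apply: (mulfI d_neq0); rewrite mulVKf // mulr1.
set c := lam k.+2 - _ + _.
have -> : lam k.+1 - lam (k + m).+2 + m%:Z = lam k.+1 - lam k.+2 + c by rewrite /c; lia.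
rewrite -[RHS]qint_mulD //; congr (_ - _).
(* For m = 0 the inner Psi is the identity and a is not raised to a + 1, but then c = 0 and the term
   vanishes anyway. *)
case: m @c {IH lam_gt kS km PE d_neq0} => [|m] c.
  by rewrite /c addn0 subrr addr0 /qint oppr0 subrr !mul0r.
by congr (_ * qint q _); rewrite /kronz; lia.
Qed.

End PsiMaximal.

(** * Contravariance of the form *)

Section BilinearForm.
Variable F : fieldType.
Implicit Types I J : finType.

Lemma bformC I (x y : based F I) : bform x y = bform y x.
Proof. by apply: eq_bigr => i _; rewrite mulrC. Qed.

Lemma bformDr I (x y z : based F I) : bform x (y + z) = bform x y + bform x z.
Proof. by rewrite -big_split; apply: eq_bigr => i _; rewrite ffunE mulrDr. Qed.

Lemma bformZr I a (x y : based F I) : bform x (a *: y) = a * bform x y.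
Proof. by rewrite /bform mulr_sumr; apply: eq_bigr => i _; rewrite ffunE mulrCA. Qed.

Lemma bform0r I (x : based F I) : bform x 0 = 0.
Proof. by rewrite -(scale0r 0) bformZr mul0r. Qed.

Lemma bform_sumr I K (r : seq K) (P : pred K) (x : based F I) (f : K -> based F I) :
  bform x (\sum_(k <- r | P k) f k) = \sum_(k <- r | P k) bform x (f k).
Proof. by elim/big_rec2: _ => [|k _ y _ <-]; rewrite ?bform0r ?bformDr. Qed.

Lemma bformDl I (x y z : based F I) : bform (y + z) x = bform y x + bform z x.
Proof. by rewrite bformC bformDr !(bformC x). Qed.

Lemma bformZl I a (x y : based F I) : bform (a *: y) x = a * bform y x.
Proof. by rewrite bformC bformZr bformC. Qed.

Lemma bform0l I (x : based F I) : bform 0 x = 0.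
Proof. by rewrite bformC bform0r. Qed.

Lemma bform_suml I K (r : seq K) (P : pred K) (x : based F I) (f : K -> based F I) :
  bform (\sum_(k <- r | P k) f k) x = \sum_(k <- r | P k) bform (f k) x.
Proof. by rewrite bformC bform_sumr; apply: eq_bigr => k _; rewrite bformC. Qed.

Lemma bform_tens I J (x x' : based F I) (y y' : based F J) :
  bform (tens x y) (tens x' y') = bform x x' * bform y y'.
Proof.
rewrite /bform mulr_suml; under [RHS]eq_bigr do rewrite mulr_sumr.
by rewrite pair_bigA; apply: eq_bigr => p _; rewrite !ffunE mulrACA.
Qed.

Definition adjoint I (A B : 'End(based F I)) :=
  forall x y, bform (A x) y = bform x (B y).

Lemma adjoint_bvec I (A B : 'End(based F I)) :
  (forall i j, bform (A (bvec F i)) (bvec F j) = bform (bvec F i) (B (bvec F j))) ->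
  adjoint A B.
Proof.
move=> AB x y; rewrite [x]based_sum [y]based_sum !linear_sum !bform_suml.
apply: eq_bigr => i _; rewrite !bform_sumr; apply: eq_bigr => j _.
by rewrite !linearZ /= !bformZl !bformZr AB.
Qed.

Lemma adjoint_diag I (A : 'End(based F I)) (c : I -> F) :
  (forall i, A (bvec F i) = c i *: bvec F i) -> adjoint A A.
Proof.
move=> Ac; apply: adjoint_bvec => i j; rewrite !Ac bformZl bformZr bform_bvec.
by case: eqP => [->|_] //; rewrite !mulr0.
Qed.

Lemma adjoint_tens I J (A A' : 'End(based F I)) (B B' : 'End(based F J)) :
  adjoint A A' -> adjoint B B' -> adjoint (tens_op A B) (tens_op A' B').
Proof.
move=> HA HB; apply: adjoint_bvec => i j.
by rewrite !(bvec_tens F i) !(bvec_tens F j) !tens_opE !bform_tens HA HB.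
Qed.

Lemma adjointD I (A A' B B' : 'End(based F I)) :
  adjoint A A' -> adjoint B B' -> adjoint (A + B) (A' + B').
Proof. by move=> HA HB x y; rewrite !add_lfunE bformDl bformDr HA HB. Qed.

Lemma adjoint_id I : adjoint \1%VF (\1%VF : 'End(based F I)).
Proof. by move=> x y; rewrite !id_lfunE. Qed.

End BilinearForm.

Section Contravariance.
Variables (F : fieldType) (q : F) (n : nat).
Hypotheses (q_neq0 : q != 0) (q_generic : not_root_of_unity q).

(** Kt_i^-1 is included because it is a factor in the coproduct of F_i, so its adjoint enters the
    tensor product step. *)
Record contravariant (I : finType) (M : uq_ops (based F I)) : Prop := Contravariant {
  contra_K i : (1 <= i <= n)%N -> adjoint (opK M i) (opK M i);
  contra_KtV i : (1 <= i < n)%N -> adjoint (opKtV M i) (opKtV M i);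
  contra_F i : (1 <= i < n)%N ->
    adjoint (opF M i) (q *: (opKtV M i \o opE M i)%VF)
}.

Lemma vvec_weight (a : nat) : has_weight q n (vector_rep q n) (kronz a) (vvec F n a).
Proof. by move=> i _; apply: vK. Qed.

Lemma bform_vvec (a b : nat) : (1 <= b <= n)%N ->
  bform (vvec F n a) (vvec F n b) = (a == b)%:R.
Proof.
move=> Hb; case: (vvecP n q_neq0 b) => [[k [-> ->]]|[_]]; last by rewrite Hb.
case: (vvecP n q_neq0 a) => [[l [-> ->]]|[-> Ha]]; first by rewrite bform_bvec.
rewrite bform0l; case: eqP => // a_k; have := ltn_ord k; lia.
Qed.

Lemma vector_rep_contravariant : contravariant (vector_rep q n).
Proof.
have Hv := vector_rep_relations n q_neq0 q_generic.
have wv k := vvec_weight k.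
split=> i Hi.
- by apply: (adjoint_diag (c := fun k : 'I_n => q ^ kronz k.+1 i)) => k; rewrite bvec_vvec vK.
- apply: (adjoint_diag (c := fun k : 'I_n => q ^ (kronz k.+1 i.+1 - kronz k.+1 i))) => k.
  by rewrite bvec_vvec (opKtV_weight q_neq0 Hv (wv _)).
- apply: adjoint_bvec => k l; rewrite !bvec_vvec scale_lfunE comp_lfunE vE // vF //.
  have [kn ln] := (ltn_ord k, ltn_ord l).
  case: (l.+1 =P i.+1) => [->|li].
    rewrite (opKtV_weight q_neq0 Hv (wv _)) // !bformZr mulrA.
    (* Kt_i^-1 acts on E_i v_(i+1) = v_i by q^-1, which the factor q in the adjoint cancels. *)
    rewrite [X in _ = X * _](_ : _ = 1).
      rewrite mul1r bform_vvec; last by lia.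
      by case: eqP => _; rewrite ?bform0l // bform_vvec ?eqxx //; lia.
    rewrite -{1}[q]expr1z -expfzDr // (_ : 1 + _ = 0) //; rewrite /kronz; lia.
  rewrite linear0 scaler0 bform0r.
  case: eqP => _; rewrite ?bform0l // bform_vvec; last by lia.
  by case: eqP => // /esym/li.
Qed.

(** Multiplying out, q Kt_i^-1 E_i acts on the tensor product as (q Kt_i^-1 E_i) (x) Kt_i^-1 + 1 (x)
    (q Kt_i^-1 E_i), which is termwise adjoint to F_i (x) Kt_i^-1 + 1 (x) F_i. *)
Lemma tens_rep_contravariant (I J : finType)
    (M : uq_ops (based F I)) (N : uq_ops (based F J)) :
  uq_relations q n M -> contravariant M -> contravariant N ->
  contravariant (tens_rep M N).
Proof.
move=> HM cM cN.
have KtVE i : opKtV (tens_rep M N) i = tens_op (opKtV M i) (opKtV N i).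
  by rewrite /opKtV /= comp_tens_op.
split=> i Hi.
- by apply: adjoint_tens; [apply: (contra_K cM)|apply: (contra_K cN)].
- by rewrite KtVE; apply: adjoint_tens; [apply: (contra_KtV cM)|apply: (contra_KtV cN)].
rewrite KtVE /= comp_lfunDr !comp_tens_op (opKtVK q_neq0 HM) // comp_lfun1r scalerDr.
rewrite -tens_opZl -tens_opZr; apply: adjointD; apply: adjoint_tens.
- exact: (contra_F cM).
- exact: (contra_KtV cN).
- exact: adjoint_id.
- exact: (contra_F cN).
Qed.

Lemma tpower_contravariant r : contravariant (tpower q n r).
Proof.
elim: r => [|r IH] /=; last first.
  by apply: tens_rep_contravariant => //; [apply: vector_rep_relations|apply: vector_rep_contravariant].
split=> i _ x y.
- by rewrite !id_lfunE.
- by rewrite /opKtV /= !comp_lfunE !id_lfunE.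
- by rewrite /= comp_lfun0r scaler0 !zero_lfunE bform0l bform0r.
Qed.

End Contravariance.

(** * Submodules generated by maximal vectors, and their orthogonality *)

Section FSpan.
Variables (F : fieldType) (q : F) (n : nat) (I : finType) (M : uq_ops (based F I)).
Hypotheses (q_neq0 : q != 0) (q_generic : not_root_of_unity q).
Hypotheses (HM : uq_relations q n M) (cM : contravariant q n M).
Implicit Types (b x y : based F I).

(** For b maximal of some weight this is the submodule generated by b, as the closure lemmas below
    show. The inductive form supplies the induction over words in the F_i. *)
Inductive Fspan b : based F I -> Prop :=
| Fspan_gen : Fspan b b
| Fspan_add x y : Fspan b x -> Fspan b y -> Fspan b (x + y)
| Fspan_scale a x : Fspan b x -> Fspan b (a *: x)
| Fspan_F i x : (1 <= i < n)%N -> Fspan b x -> Fspan b (opF M i x).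

Lemma Fspan_Psi b k lam m x : (k + m < n)%N -> Fspan b x ->
  Fspan b (Psi_shift q k (opF M) lam m x).
Proof.
elim: m k x => [|m IH] k x km bx; first by rewrite Psi_shift0 id_lfunE.
have Hk : (1 <= k.+1 < n)%N by lia.
have kS : (k.+1 + m < n)%N by lia.
rewrite Psi_shiftS // -scaleNr; apply: Fspan_scale.
by apply: Fspan_add; apply: Fspan_scale; [apply: Fspan_F|]; auto; apply/IH/Fspan_F.
Qed.

Section Closure.
Variables (b : based F I) (lam : nat -> int).
Hypotheses (wb : has_weight q n M lam b).
Hypothesis (Eb : forall i, (1 <= i < n)%N -> opE M i b = 0).

Lemma Fspan_opKt i x : (1 <= i < n)%N -> Fspan b x -> Fspan b (opKt M i x).
Proof.
move=> Hi; elim=> {x} [|x y _ IHx _ IHy|a x _ IH|j x Hj _ IH].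
- by rewrite (opKt_weight q_neq0 HM wb Hi); apply/Fspan_scale/Fspan_gen.
- by rewrite linearD; apply: Fspan_add.
- by rewrite linearZ; apply: Fspan_scale.
- by rewrite (lfunZP (KtF q_neq0 HM Hi Hj)); apply/Fspan_scale/Fspan_F.
Qed.

Lemma Fspan_opKtV i x : (1 <= i < n)%N -> Fspan b x -> Fspan b (opKtV M i x).
Proof.
move=> Hi; elim=> {x} [|x y _ IHx _ IHy|a x _ IH|j x Hj _ IH].
- by rewrite (opKtV_weight q_neq0 HM wb Hi); apply/Fspan_scale/Fspan_gen.
- by rewrite linearD; apply: Fspan_add.
- by rewrite linearZ; apply: Fspan_scale.
- by rewrite (lfunZP (KtVF q_neq0 HM Hi Hj)); apply/Fspan_scale/Fspan_F.
Qed.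

(** E_i moves past each F_j, leaving terms in Kt_i and Kt_i^-1, until it reaches b and kills it. *)
Lemma Fspan_opE i x : (1 <= i < n)%N -> Fspan b x -> Fspan b (opE M i x).
Proof.
move=> Hi; elim=> {x} [|x y _ IHx _ IHy|a x _ IH|j x Hj bx IH].
- by rewrite Eb // -(scale0r b); apply/Fspan_scale/Fspan_gen.
- by rewrite linearD; apply: Fspan_add.
- by rewrite linearZ; apply: Fspan_scale.
- rewrite (opE_opF HM) // -scaleN1r; apply: Fspan_add; first exact: Fspan_F.
  do 2!apply: Fspan_scale; apply: Fspan_add; first exact: Fspan_opKt.
  exact/Fspan_scale/Fspan_opKtV.
Qed.

End Closure.

(** An F_i on the left moves to the right as q Kt_i^-1 E_i, which preserves [Fspan b']. Once the
    left argument is b itself, an F_i on the right moves to the left, where E_i kills b. *)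
Lemma Fspan_orthogonal b b' lam lam' x y :
  has_weight q n M lam b -> (forall i, (1 <= i < n)%N -> opE M i b = 0) ->
  has_weight q n M lam' b' -> (forall i, (1 <= i < n)%N -> opE M i b' = 0) ->
  bform b b' = 0 -> Fspan b x -> Fspan b' y -> bform x y = 0.
Proof.
move=> wb Eb wb' Eb' bb' bx; elim: bx y => {x} [|x x' _ IH _ IH'|a x _ IH|i x Hi _ IH] y b'y.
- elim: b'y => {y} [|y y' _ IH _ IH'|a y _ IH|i y Hi _ IH] //.
  + by rewrite bformDr IH IH' addr0.
  + by rewrite bformZr IH mulr0.
  + rewrite bformC (contra_F cM Hi) scale_lfunE comp_lfunE Eb // linear0.
    by rewrite scaler0 bform0r.
- by rewrite bformDl IH // IH' // addr0.
- by rewrite bformZl IH // mulr0.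
- rewrite (contra_F cM Hi) scale_lfunE comp_lfunE bformZr IH ?mulr0 //.
  by apply: (Fspan_opKtV wb') => //; apply: (Fspan_opE wb').
Qed.

(** K_i is self-adjoint, and its eigenvalues on x and y differ since q is not a root of unity. *)
Lemma weight_orthogonal lam mu i x y : (1 <= i <= n)%N -> lam i <> mu i ->
  has_weight q n M lam x -> has_weight q n M mu y -> bform x y = 0.
Proof.
move=> Hi ne wx wy; have := contra_K cM Hi x y; rewrite wx // wy // bformZl bformZr.
move/eqP; rewrite -subr_eq0 -mulrBl mulf_eq0 subr_eq0.
by case/orP => /eqP // /(expfz_generic_inj q_neq0 q_generic).
Qed.

End FSpan.

(** * The operators Phi *)

Section Slices.
Variables (F : fieldType) (I J : finType).
Implicit Types (x y : based F (I * J)%type).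

Definition slice (i : I) x : based F J := [ffun j => x (i, j)].

Lemma slice_is_linear i : linear (slice i).
Proof. by move=> a x y; apply/ffunP => j; rewrite !ffunE. Qed.

HB.instance Definition _ i :=
  GRing.isLinear.Build F (based F (I * J)%type) (based F J) *:%R (slice i)
    (slice_is_linear i).

Lemma tens0l (y : based F J) : tens (0 : based F I) y = 0.
Proof. by apply/ffunP => p; rewrite !ffunE mul0r. Qed.

Lemma tens0r (x : based F I) : tens x (0 : based F J) = 0.
Proof. by apply/ffunP => p; rewrite !ffunE mulr0. Qed.

Lemma slice_tens i v (y : based F J) : slice i (tens v y) = v i *: y.
Proof. by apply/ffunP => j; rewrite !ffunE. Qed.

Lemma slice_sum x : x = \sum_i tens (bvec F i) (slice i x).
Proof.
apply/ffunP => -[i j]; rewrite sum_ffunE (bigD1 i) //= big1 => [|k /negPf ki].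
  by rewrite !ffunE eqxx mul1r addr0.
by rewrite !ffunE /= eq_sym ki mul0r.
Qed.

Lemma slice_eq0 x : (forall i, slice i x = 0) -> x = 0.
Proof.
move=> x0; rewrite [x]slice_sum big1 // => i _; by rewrite x0 tens0r.
Qed.

End Slices.

Section PhiMaximal.
Variables (F : fieldType) (q : F) (n : nat) (J : finType) (N : uq_ops (based F J)).
Hypotheses (q_neq0 : q != 0) (q_generic : not_root_of_unity q).
Hypothesis (HN : uq_relations q n N).

Let HV := vector_rep_relations n q_neq0 q_generic.
Let VN := tens_rep (vector_rep q n) N.

Lemma has_weight_tens (I : finType) (M : uq_ops (based F I)) lam mu u v :
  has_weight q n M lam u -> has_weight q n N mu v ->
  has_weight q n (tens_rep M N) (fun i => lam i + mu i) (tens u v).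
Proof.
move=> wu wv i Hi; rewrite tens_opE wu // wv // tensZl tensZr scalerA.
by rewrite expfzDr.
Qed.

Section Maximal.
Variables (lam : nat -> int) (b : based F J) (m : nat).
Hypotheses (wb : has_weight q n N lam b).
Hypothesis (Eb : forall i, (1 <= i < n)%N -> opE N i b = 0).
Hypothesis (m_range : (1 <= m <= n)%N).

(** Extends [opE_Psi] to i <= k, where E_i commutes with every F occurring in Psi. *)
Lemma opE_Psi_maximal k j i : (k + j < n)%N -> (1 <= i < n)%N ->
  (forall l, (k < l <= k + j)%N -> lam (k + j).+1 < lam l) ->
  opE N i (Psi_shift q k (opF N) lam j b) =
    if (0 < j)%N && (i == k.+1) then Psi_shift q k.+1 (opF N) lam j.-1 b else 0.
Proof.
move=> kj Hi lam_gt; case: (ltnP k i) => ki.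
  by apply: (opE_Psi q_neq0 q_generic HN) => // [|l Hl]; [|apply: Eb]; lia.
rewrite (_ : (i == k.+1) = false) ?andbF; last by lia.
rewrite (Psi_shift_comm q_neq0 q_generic) ?Eb ?linear0 // => l y Hl.
rewrite (opE_opF HN) //; last by lia.
by rewrite (_ : (i == l) = false) ?scale0r ?addr0 //; lia.
Qed.

Lemma Phi_weight : has_weight q n VN (fun i => lam i + kronz m i) (Phi q n N lam m b).
Proof.
rewrite /Phi big_mkord; elim/big_rec: _ => [i _|j x _ wx].
  by rewrite linear0 scaler0.
apply: has_weightD => //; apply: has_weightZ.
(* In the j-th term, v_(m-j) contributes eps_(m-j) and Psi contributes eps_m - eps_(m-j). *)
have [mj jm] : (m - j - 1 + j < n)%N /\ (m - j - 1).+1 = (m - j)%N.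
  by have := ltn_ord j; lia.
apply: eq_has_weight (has_weight_tens (vvec_weight q_neq0 (m - j))
  (has_weight_Psi q_neq0 q_generic HN lam mj wb)).
by move=> i _; rewrite /= /kronz; have := ltn_ord j; lia.
Qed.

Hypothesis (lam_gt : forall l, (1 <= l < m)%N -> lam m < lam l).

(** The two summands of the coproduct of E_i send the j-th term to [A j] and [B j]. Then [A j]
    cancels [B j.+1]: both can be nonzero only for m - j = i + 1, and there Kt_i v_i = q v_i absorbs
    one factor -q^-1 up to sign. The end terms vanish because E_i kills b and v_1. *)
Lemma Phi_maximal i : (1 <= i < n)%N -> opE VN i (Phi q n N lam m b) = 0.
Proof.
move=> Hi; rewrite /Phi linear_sum /=.
pose X j := Psi_shift q (m - j - 1) (opF N) lam j b.
pose A j := (- q^-1) ^+ j *: tens (opE (vector_rep q n) i (vvec F n (m - j))) (X j).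
pose B j := (- q^-1) ^+ j *:
  tens (opKt (vector_rep q n) i (vvec F n (m - j))) (opE N i (X j)).
have EX j : (j < m)%N -> opE N i (X j) =
    if (0 < j)%N && (i == m - j)%N then X j.-1 else 0.
  move=> jm; rewrite /X opE_Psi_maximal //; try lia; last first.
    move=> l Hl; rewrite (_ : (m - j - 1 + j).+1 = m); last by lia.
    by apply: lam_gt; lia.
  rewrite (_ : (m - j - 1).+1 = m - j)%N; last by lia.
  case: (j) jm => [|j'] jm //=; rewrite (_ : m - j'.+1 = m - j' - 1)%N //; lia.
transitivity (\sum_(0 <= j < m) (A j + B j)).
  by apply: eq_bigr => j _; rewrite linearZ /= add_lfunE !tens_opE !id_lfunE scalerDr.
have B0 : B 0%N = 0.
  rewrite /B EX /=; last by case/andP: m_range.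
  by rewrite tens0r scaler0.
have AB j : (j.+1 < m)%N -> A j + B j.+1 = 0.
  move=> jm; rewrite /A /B EX // vE //=.
  rewrite (_ : (m - j == i.+1) = (i == m - j.+1))%N; last by lia.
  case: eqP => [->|_]; last first.
    by rewrite tens0l tens0r !scaler0 addr0.
  rewrite (opKt_weight q_neq0 HV (vvec_weight q_neq0 _)); last by lia.
  rewrite (_ : kronz _ _ - kronz _ _ = 1); last by rewrite /kronz; lia.
  rewrite expr1z tensZl scalerA exprS mulrAC mulNr mulVf // mulN1r scaleNr.
  by rewrite subrr.
have Am : A m.-1 = 0.
  rewrite /A (_ : m - m.-1 = 1)%N; last by lia.
  rewrite vE // (_ : (1 == i.+1) = false)%N; last by lia.
  by rewrite tens0l scaler0.
rewrite big_split /=.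
case: (m) m_range A B B0 AB Am {EX} => // m1 Hm1 A B B0 AB Am.
rewrite big_nat_recr //= Am addr0 big_nat_recl //= B0 add0r.
rewrite -big_split big_nat big1 //= => j Hj; apply: AB; lia.
Qed.

End Maximal.

(** Only the term j = 0 lies along v_m; the others lie along v_(m-j) with m - j < m. This
    triangularity serves both independence and spanning. *)
Lemma slice_Phi lam m b (k : 'I_n) : (1 <= m)%N -> (m <= k.+1)%N ->
  slice k (Phi q n N lam m b) = (k.+1 == m)%:R *: b.
Proof.
move=> m1 mk; rewrite /Phi linear_sum /=.
case: m m1 mk => // m _ mk; rewrite big_nat_recl //= big_nat big1 ?addr0 => [|j Hj].
  rewrite linearZ /= expr0 scale1r slice_tens ffunE subn0.
  by rewrite /Psi_shift /= id_lfunE.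
rewrite linearZ /= slice_tens ffunE (_ : (k.+1 == m.+1 - j.+1) = false)%N; last by lia.
by rewrite scale0r scaler0.
Qed.

(** The second tensor factors of the two sums lie in [Fspan b] and [Fspan b'], so all products of
    terms vanish. *)
Lemma Phi_orthogonal lam lam' m m' b b' :
  (m <= n)%N -> (m' <= n)%N -> contravariant q n N ->
  has_weight q n N lam b -> (forall i, (1 <= i < n)%N -> opE N i b = 0) ->
  has_weight q n N lam' b' -> (forall i, (1 <= i < n)%N -> opE N i b' = 0) ->
  bform b b' = 0 ->
  bform (Phi q n N lam m b) (Phi q n N lam' m' b') = 0.
Proof.
move=> mn mn' cN wb Eb wb' Eb' bb'.
rewrite /Phi bform_suml big_nat big1 // => j Hj; rewrite bform_sumr big_nat big1 // => j' Hj'.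
rewrite bformZl bformZr bform_tens (Fspan_orthogonal q_neq0 HN cN wb Eb wb' Eb' bb').
- by rewrite !mulr0.
- by apply: Fspan_Psi => //; [lia|apply: Fspan_gen].
- by apply: Fspan_Psi => //; [lia|apply: Fspan_gen].
Qed.

End PhiMaximal.

(** * Lattice words and sl_2-theory on the tensor powers *)

(* A walk is encoded by the rows of its boxes, the last box first: the shape
   after all steps of [w] is [cont w], and [lattice w] says that every
   intermediate shape is a partition. *)

Section LatticeWords.
Variable n : nat.

Fixpoint cont (r : nat) : word n r -> nat -> nat :=
  match r return word n r -> nat -> nat with
  | 0 => fun _ _ => 0%N
  | r'.+1 => fun (w : 'I_n * word n r') i => (cont w.2 i + (w.1.+1 == i))%N
  end.

Fixpoint lattice (r : nat) : word n r -> bool :=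
  match r return word n r -> bool with
  | 0 => fun _ => true
  | r'.+1 => fun (w : 'I_n * word n r') =>
      lattice w.2 && ((w.1 == 0 :> nat)%N || (cont w.2 w.1.+1 < cont w.2 w.1)%N)
  end.

Definition contz (r : nat) (w : word n r) (i : nat) : int := (cont w i)%:Z.

Lemma cont_le r (w : word n r) i : (cont w i <= r)%N.
Proof. by elim: r w => // r IH [k w] /=; have := IH w; case: eqP => _; lia. Qed.

Lemma lattice_decr r (w : word n r) i : lattice w -> (0 < i)%N ->
  (cont w i.+1 <= cont w i)%N.
Proof.
elim: r w => // r IH [k w] /= /andP [lw kw] i0; have := IH w lw i0.
by case: (k.+1 =P i.+1) => [[ki]|_]; case: (k.+1 =P i) => [ki'|_]; move: kw; rewrite ?ki; lia.
Qed.

(** The lattice condition compares the new row only with its predecessor; weak decrease carries the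
    inequality up to all earlier rows. This is the strict inequality that [Phi_maximal] asks for. *)
Lemma lattice_lt r (k : 'I_n) (w : word n r) l : lattice (r := r.+1) (k, w) ->
  (1 <= l <= k)%N -> (cont w k.+1 < cont w l)%N.
Proof.
move=> /= /andP [lw kw] Hl.
have {kw} lt_k : (cont w k.+1 < cont w k)%N by move: kw; case: eqP => //; lia.
have le d : (0 < k - d)%N -> (cont w k <= cont w (k - d))%N.
  elim: d => [|d IH] kd; first by rewrite subn0.
  apply: leq_trans (IH _) _; first by lia.
  have := @lattice_decr r w (k - d.+1) lw kd; rewrite (_ : (k - d.+1).+1 = k - d)%N //; lia.
have := le (k - l)%N; rewrite subKn; lia.
Qed.

End LatticeWords.

Section TensorPower.
Variables (F : fieldType) (q : F) (n : nat).
Hypotheses (q_neq0 : q != 0) (q_generic : not_root_of_unity q).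
Notation T r := (tpower q n r).
Let HT r : uq_relations q n (T r) := tpower_relations n q_neq0 q_generic r.
Let HV : uq_relations q n (vector_rep q n) := vector_rep_relations n q_neq0 q_generic.

Lemma bvec_weight r (w : word n r) : has_weight q n (T r) (contz w) (bvec F w).
Proof.
elim: r w => [|r IH] w; first by move=> i _; rewrite /= id_lfunE scale1r.
case: w => k w; rewrite bvec_tens bvec_vvec.
apply: eq_has_weight (has_weight_tens q_neq0 (vvec_weight q_neq0 k.+1) (IH w)).
by move=> i _; rewrite /contz /= /kronz; lia.
Qed.

Section SL2.
Variables (r i : nat).
Hypothesis (Hi : (1 <= i < n)%N).
Let hw (w : word n r) : int := contz w i - contz w i.+1.

Lemma opKtE x w : opKt (T r) i x w = q ^ hw w * x w.
Proof.
rewrite {1}[x]based_sum linear_sum sum_ffunE (bigD1 w) //= big1 => [|u /negPf uw].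
  rewrite linearZ /= (opKt_weight q_neq0 (HT r) (bvec_weight w)) // !ffunE eqxx.
  by rewrite addr0 /GRing.scale /= mulr1 mulrC.
rewrite linearZ /= (opKt_weight q_neq0 (HT r) (bvec_weight u)) // !ffunE eq_sym uw.
by rewrite !scaler0.
Qed.

Lemma eigen_support (s : int) x w : opKt (T r) i x = q ^ s *: x -> hw w != s -> x w = 0.
Proof.
move=> /ffunP/(_ w); rewrite opKtE ffunE => /eqP; rewrite -subr_eq0 -mulrBl mulf_eq0.
by rewrite subr_eq0 => /orP [/eqP/(expfz_generic_inj q_neq0 q_generic) ->|/eqP]; rewrite ?eqxx.
Qed.

Lemma opE_eigen (s : int) x : opKt (T r) i x = q ^ s *: x ->
  opKt (T r) i (opE (T r) i x) = q ^ (s + 2) *: opE (T r) i x.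
Proof.
move=> Ktx; rewrite (lfunZP (KtE q_neq0 (HT r) Hi Hi)) Ktx linearZ /= scalerA.
by rewrite cartan_refl -expfzDr // addrC.
Qed.

Lemma opF_eigen (s : int) x : opKt (T r) i x = q ^ s *: x ->
  opKt (T r) i (opF (T r) i x) = q ^ (s - 2) *: opF (T r) i x.
Proof.
move=> Ktx; rewrite (lfunZP (KtF q_neq0 (HT r) Hi Hi)) Ktx linearZ /= scalerA.
by rewrite cartan_refl -expfzDr // addrC.
Qed.

(* Otherwise [F^k z] would be nonzero for all [k]. *)
Lemma sl2_weightN2_eq0 z : opKt (T r) i z = q ^ (-2 : int) *: z ->
  opF (T r) i (opE (T r) i z) = 0 -> z = 0.
Proof.
move=> Ktz FEz; pose Fk k := iter k (opF (T r) i) z.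
have KtFk k : opKt (T r) i (Fk k) = q ^ (-2 - 2 * k%:Z) *: Fk k.
  elim: k => [|k IH]; first by rewrite mulr0 subr0.
  by rewrite /= (opF_eigen IH); congr (q ^ _ *: _); lia.
(* These coefficients never vanish, so [Fk k.+1 = 0] forces [Fk k = 0]. *)
have EFk k : opE (T r) i (Fk k.+1) = - (qint q k.+1%:Z * qint q k.+2%:Z) *: Fk k.
  elim: k => [|k IH].
    rewrite /= (opE_opF_eigen q_neq0 (HT r) Hi Ktz) FEz add0r qintN.
    congr (- _ *: _); rewrite -[LHS]mul1r; congr (_ * _).
    by rewrite /qint expr1z divff // subrV_generic_neq0.
  rewrite {1}/Fk iterS -/(Fk k.+1) (opE_opF_eigen q_neq0 (HT r) Hi (KtFk _)).
  rewrite IH linearZ /= -/(Fk k.+1) -scalerDl; congr (_ *: _).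
  (* The coefficients match by [k+2][k+3] - [k+1][k+2] = [2k+4], which is [qint_mulD] with a = c = k
     + 2. *)
  rewrite (_ : -2 - 2 * k.+1%:Z = - (k.+2%:Z + k.+2%:Z)); last by lia.
  rewrite qintN -opprD -qint_mulD // addrC.
  rewrite (_ : k.+2%:Z - 1 = k.+1); last by lia.
  by rewrite (_ : k.+2%:Z + 1 = k.+3) ?subrK //; lia.
(* The Kt_i-weights on the r-th tensor power are at least -r, while F^r z would have weight -2 -
   2r. *)
have Fr0 : Fk r = 0.
  apply/ffunP => w; rewrite [RHS]ffunE; apply: (eigen_support (KtFk r)).
  by have := cont_le w i.+1; rewrite /hw /contz; lia.
have: forall k, Fk k = 0 -> z = 0.
  elim=> // k IH Fk0; apply: IH.
  have := EFk k; rewrite Fk0 linear0 => /esym/eqP; rewrite scaler_eq0 oppr_eq0 mulf_eq0.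
  by rewrite !qint_eq0 //= => /eqP.
by move/(_ r Fr0).
Qed.

(* [y0] is the component of weight 0 of [E z]; the component of weight -2 of
   [z] is then killed by [F E] and [E E]. *)
Lemma opE_weight0_eq0 y0 y1 z : y0 + y1 = opE (T r) i z ->
  opKt (T r) i y0 = y0 -> (forall w, hw w = 0 -> y1 w = 0) ->
  opE (T r) i y0 = 0 -> y0 = 0.
Proof.
move=> yz Kty0 y1_0 Ey0.
pose z0 : based F (word n r) := [ffun w => if hw w == -2 then z w else 0].
have Ktz0 : opKt (T r) i z0 = q ^ (-2 : int) *: z0.
  apply/ffunP => w; rewrite opKtE !ffunE.
  by case: eqP => [->|_] //; rewrite mulr0 scaler0.
have Ktb u : opKt (T r) i (bvec F u) = q ^ hw u *: bvec F u.
  exact: (opKt_weight q_neq0 (HT r) (bvec_weight u)).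
(* E_i raises the Kt_i-weight by 2, so the weight 0 part of E z comes from the weight -2 part of
   z. *)
have Ez0 : opE (T r) i z0 = y0.
  apply/ffunP => w; case: (hw w =P 0) => hw0; last first.
    rewrite (eigen_support (opE_eigen Ktz0)); last by rewrite addNr; apply/eqP.
    by rewrite (@eigen_support 0 y0) ?expr0z ?scale1r //; apply/eqP.
  have -> : y0 w = opE (T r) i z w by rewrite -yz ffunE y1_0 ?addr0.
  rewrite [z]based_sum [z0]based_sum !linear_sum !sum_ffunE; apply: eq_bigr => u _.
  rewrite !linearZ /= !ffunE; case: eqP => // /eqP hwu.
  rewrite (eigen_support (opE_eigen (Ktb u))) ?scaler0 //.
  apply/eqP; move: hwu; rewrite hw0; move: (hw u) => h; lia.
have z00 : opF (T r) i (opE (T r) i z0) = 0.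
  rewrite Ez0.
  (* The lemma is applied first to F y0, which has weight -2 and satisfies E F y0 = F E y0 + [0] y0
     = 0, and afterwards to [z0]. *)
  apply: sl2_weightN2_eq0; first by rewrite (@opF_eigen 0) // expr0z scale1r.
  by rewrite (@opE_opF_eigen _ _ _ _ _ q_neq0 (HT r) _ 0) ?Ey0 ?linear0 ?add0r
    ?expr0z ?scale1r // /qint subrr mul0r scale0r linear0.
by rewrite -Ez0 (sl2_weightN2_eq0 Ktz0 z00) linear0.
Qed.

End SL2.

End TensorPower.

(** * The basis indexed by lattice words *)

Section WordVectors.
Variables (F : fieldType) (q : F) (n : nat).

(** Defined on all words to avoid a dependent type. On lattice words the denominators in Psi are
    nonzero; elsewhere a zero denominator has inverse 0 by convention. *)
Fixpoint word_vec (r : nat) : word n r -> based F (word n r) :=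
  match r return word n r -> based F (word n r) with
  | 0 => fun w => bvec F w
  | r'.+1 => fun (w : 'I_n * word n r') =>
      Phi q n (tpower q n r') (contz w.2) w.1.+1 (word_vec w.2)
  end.

Hypotheses (q_neq0 : q != 0) (q_generic : not_root_of_unity q).
Notation T r := (tpower q n r).
Let HT r : uq_relations q n (T r) := tpower_relations n q_neq0 q_generic r.
Let HV : uq_relations q n (vector_rep q n) := vector_rep_relations n q_neq0 q_generic.

Definition maximal r (x : based F (word n r)) :=
  forall i, (1 <= i < n)%N -> opE (T r) i x = 0.

Lemma word_vec_weight r (w : word n r) : has_weight q n (T r) (contz w) (word_vec w).
Proof.
elim: r w => [|r IH] w; first exact: bvec_weight.
case: w => k w; have kn := ltn_ord k.
have := Phi_weight q_neq0 q_generic (HT r) (m := k.+1) (IH w) kn.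
by apply: eq_has_weight => i _; rewrite /contz /= /kronz; lia.
Qed.

Lemma word_vec_maximal r (w : word n r) : lattice w -> maximal (word_vec w).
Proof.
elim: r w => [|r IH] w; first by move=> _ i _; rewrite /= zero_lfunE.
case: w => k w lkw i Hi; have kn := ltn_ord k.
have lw : lattice w by case/andP: lkw.
apply: (Phi_maximal q_neq0 q_generic (HT r) (word_vec_weight w) (IH w lw)) => // l Hl.
by rewrite /contz /= ltz_nat (lattice_lt lkw).
Qed.

Lemma word_vec_orthogonal r (w w' : word n r) : lattice w -> lattice w' ->
  w != w' -> bform (word_vec w) (word_vec w') = 0.
Proof.
elim: r w w' => [|r IH] w w'; first by case: w; case: w'.
case: w w' => [k w] [k' w'] lkw lkw' ne.
have lw : lattice w by case/andP: lkw.
have lw' : lattice w' by case/andP: lkw'.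
case: (eqVneq w w') => [eq_w|ne_w].
  have {ne} kk' : k != k' by apply: contraNneq ne => ->; rewrite eq_w.
  apply: (weight_orthogonal q_neq0 q_generic (tpower_contravariant n q_neq0 q_generic r.+1)
    (i := k.+1) _ _ (word_vec_weight (r := r.+1) (k, w)) (word_vec_weight (r := r.+1) (k', w'))).
    by have := ltn_ord k.
  by move: kk'; rewrite /contz /= eq_w -val_eqE eqxx eqSS eq_sym /=; case: eqP => // _ _; lia.
apply: (Phi_orthogonal q_neq0 q_generic (HT r) _ _ (tpower_contravariant n q_neq0 q_generic r)
  (word_vec_weight w) (word_vec_maximal lw) (word_vec_weight w') (word_vec_maximal lw')).
- by have := ltn_ord k.
- by have := ltn_ord k'.
- exact: IH.
Qed.

Lemma slice_word_vec r (k : 'I_n) (w : word n r.+1) : (w.1 <= k)%N ->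
  slice k (word_vec w) = (k == w.1)%:R *: word_vec w.2.
Proof. by move=> wk; rewrite slice_Phi. Qed.

(** Take the largest last letter k with a nonzero coefficient. Along v_(k+1) only words with last
    letter k contribute, each through the vector of its tail, which leaves a shorter relation. *)
Lemma word_vec_free r (a : word n r -> F) :
  \sum_(w | lattice w) a w *: word_vec w = 0 -> forall w, lattice w -> a w = 0.
Proof.
elim: r a => [|r IH] a sum0 w lw.
  move: sum0; rewrite (bigD1 w) //= big1 ?addr0 => [/ffunP/(_ w)|u]; last by case: u; case: (w).
  by rewrite !ffunE eqxx /GRing.scale /= mulr1.
apply/eqP/negPn/negP => aw.
pose P (u : word n r.+1) := lattice u && (a u != 0).
have Pw : P w by rewrite /P lw.
case: (@arg_maxnP _ w P (fun u => u.1 : nat) Pw) => -[k u] /andP [lku aku] k_max.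
pose b u := if lattice (r := r.+1) (k, u) then a (k, u) else 0.
have sb0 : \sum_(u | lattice u) b u *: word_vec u = 0.
  move: (congr1 (slice k) sum0); rewrite linear0 linear_sum /= => S0.
  rewrite -[RHS]S0 {S0 sum0}.
  rewrite (eq_bigr (fun u : word n r.+1 => (if u.1 == k then a u else 0) *: word_vec u.2)).
    rewrite big_mkcond /= [RHS]big_mkcond /=.
    rewrite [RHS](_ : _ = \sum_(l < n) \sum_(u : word n r)
      if lattice (r := r.+1) (l, u) then (if l == k then a (l, u) else 0) *: word_vec u else 0);
      last by rewrite pair_bigA; apply: eq_bigr => -[].
    rewrite [RHS](bigD1 k) //= [X in _ = _ + X]big1 ?addr0 => [|l /negPf lk].
      apply: eq_bigr => v _; rewrite eqxx /b /=.
      by case: (lattice v) => //=; case: ifP => //; rewrite scale0r.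
    by apply: big1 => v _; rewrite lk scale0r; case: ifP.
  move=> [l v] lv; rewrite linearZ /=.
  case: (ltnP k l) => kl.
    have -> : a (l, v) = 0.
      apply/eqP/negPn/negP => alv.
      have Plv : P (l, v) by apply/andP; split.
      by have := k_max _ Plv; rewrite /= leqNgt kl.
    by rewrite if_same !scale0r.
  rewrite (slice_word_vec (w := (l, v))) //= eq_sym scalerA.
  by case: eqP; rewrite ?mulr1 ?mulr0.
have lu : lattice u by case/andP: lku.
by move: (IH b sb0 u lu) aku; rewrite /b lku => ->; rewrite eqxx.
Qed.

(** * Spanning by the vectors of lattice words *)

Definition word_comb r (x : based F (word n r)) :=
  exists a, x = \sum_(w | lattice w) a w *: word_vec w.

Lemma word_combD r (x y : based F (word n r)) :
  word_comb x -> word_comb y -> word_comb (x + y).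
Proof.
move=> [a ->] [b ->]; exists (fun w => a w + b w).
by rewrite -big_split; apply: eq_bigr => w _; rewrite scalerDl.
Qed.

Lemma word_comb0 r : word_comb (0 : based F (word n r)).
Proof. by exists (fun=> 0); rewrite big1 // => w _; rewrite scale0r. Qed.

Lemma word_comb_vec r a (w : word n r) : lattice w -> word_comb (a *: word_vec w).
Proof.
move=> lw; exists (fun u => if u == w then a else 0).
rewrite (bigD1 w) //= eqxx big1 ?addr0 // => u /andP [_ /negPf ->].
by rewrite scale0r.
Qed.

(** The first summand comes from E_i v_(i+1) = v_i. The ordinal with value i stands for v_(i+1), so
    the sum has a single term and merely avoids building that ordinal. *)
Lemma slice_opE (J : finType) (N : uq_ops (based F J)) i (k : 'I_n)
    (x : based F ('I_n * J)%type) : (1 <= i < n)%N ->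
  slice k (opE (tens_rep (vector_rep q n) N) i x) =
    (if k.+1 == i then \sum_(l < n | (l == i :> nat)%N) slice l x else 0)
    + q ^ (kronz k.+1 i - kronz k.+1 i.+1) *: opE N i (slice k x).
Proof.
move=> Hi; rewrite {1}[x]slice_sum linear_sum linear_sum /=.
rewrite (eq_bigr (fun l : 'I_n => (if (k.+1 == i) && (l == i :> nat)%N then slice l x else 0)
  + (if l == k then q ^ (kronz k.+1 i - kronz k.+1 i.+1) *: opE N i (slice k x) else 0))).
  rewrite big_split /= [X in _ + X](bigD1 k) //= eqxx [X in _ + (_ + X)]big1 ?addr0.
    by congr (_ + _); case: eqP => //= _; rewrite -?big_mkcond // big1.
  by move=> l /negPf ->.
move=> l _; rewrite add_lfunE !tens_opE id_lfunE linearD /= !slice_tens !bvec_vvec.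
rewrite (vE q_neq0) // (opKt_weight q_neq0 HV (vvec_weight q_neq0 _)) // eqSS; congr (_ + _).
  case: (l =P i :> nat) => _; last by rewrite andbF ffunE scale0r.
  by rewrite andbT ffunE; case: eqP => _; rewrite ?scale1r ?scale0r.
rewrite !ffunE eqSS eq_sym val_eqE; case: eqP => [->|_].
  by congr (_ *: _); apply: mulr1.
by rewrite scaler0 scale0r.
Qed.

(** The k-th component of E_i x is a power of q times E_i x_k, plus x_(k+1) when i = k + 1, and the
    latter vanishes. *)
Lemma maximal_lead_slice r (k : 'I_n) (x : based F (word n r.+1)) : maximal x ->
  (forall l : 'I_n, (k < l)%N -> slice l x = 0) -> maximal (slice k x).
Proof.
move=> mx x_gt i Hi; have := congr1 (slice k) (mx i Hi).
rewrite /= slice_opE // linear0 (_ : (if _ then _ else _) = 0).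
  by rewrite add0r => /eqP; rewrite scaler_eq0 expfz_eq0 (negPf q_neq0) andbF => /eqP.
by case: eqP => // ki; rewrite big1 // => l /eqP li; rewrite x_gt //; lia.
Qed.

(** Read off the l-th component of E_k x = 0. The ordinals l and k stand for v_k and v_(k+1), and
    Kt_k v_k = q v_k. *)
Lemma maximal_slice_pred r (k l : 'I_n) (x : based F (word n r.+1)) : maximal x ->
  k = l.+1 :> nat -> slice k x = opE (T r) k (- q *: slice l x).
Proof.
move=> mx kl; have Hk : (1 <= k < n)%N by have := ltn_ord k; lia.
have := congr1 (slice l) (mx k Hk).
rewrite /= slice_opE // linear0 -kl eqxx (_ : \sum_(_ < n | _) _ = slice k x).
  rewrite (_ : kronz _ _ - _ = 1); last by rewrite /kronz; lia.
  by rewrite expr1z linearZ /= scaleNr => /eqP; rewrite addr_eq0 => /eqP.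
by rewrite (eq_bigl (pred1 k)) ?big_pred1_eq // => j; rewrite -val_eqE.
Qed.

Lemma maximal_word_comb r (x : based F (word n r)) : maximal x -> word_comb x.
Proof.
elim: r x => [|r IH] x mx.
  rewrite [x]based_sum; elim/big_ind: _ => [|y z|w _].
  - exact: word_comb0.
  - exact: word_combD.
  - exact: word_comb_vec.
(* The inner induction lowers the bound d from which on all components of x vanish. *)
have [d] : {d | (d <= n)%N & forall l : 'I_n, (d <= l)%N -> slice l x = 0}.
  by exists n => // l; rewrite leqNgt ltn_ord.
elim: d x mx => [|d IHd] x mx dn x_ge.
  by rewrite (slice_eq0 (x := x)); [apply: word_comb0|move=> l; apply: x_ge].
pose k := Ordinal dn.
have [a xk] := IH _ (maximal_lead_slice (k := k) mx x_ge : maximal (slice k x)).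
have {}xk : slice k x = \sum_(u | lattice (r := r.+1) (k, u)) a u *: word_vec u.
  case: (posnP d) => d0.
    by rewrite xk; apply: eq_bigl => u; rewrite /= d0 andbT.
  have ld : (d.-1 < n)%N by lia.
  have kl : k = (Ordinal ld).+1 :> nat by rewrite /= prednK.
  have Hd : (1 <= d < n)%N by lia.
  move: (maximal_slice_pred mx kl); rewrite xk /= => xE.
  (* [y0] collects the u whose rows d and d + 1 are equal, so that row d + 1 admits no box. It has
     Kt_d-weight 0, while [y1] has only positive weights. *)
  rewrite (bigID (fun u => cont u d.+1 < cont u d)%N) /= addrC in xE *.
  set y0 := \sum_(_ | _ && ~~ _) _ in xE *.
  set y1 := \sum_(_ | _) _ in xE *.
  suff -> : y0 = 0.
    by rewrite add0r; apply: eq_bigl => u; rewrite /= (gtn_eqF d0).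
  apply: (opE_weight0_eq0 q_neq0 q_generic Hd xE).
  - rewrite linear_sum; apply: eq_bigr => u /andP [lu ltu]; rewrite linearZ /=.
    rewrite (opKt_weight q_neq0 (HT r) (word_vec_weight u)) //.
    rewrite (_ : contz u d - _ = 0) ?expr0z ?scale1r //.
    by have := lattice_decr lu d0; rewrite /contz; lia.
  - move=> w hw0; rewrite sum_ffunE big1 // => u /andP [lu ltu]; rewrite ffunE.
    rewrite (eigen_support q_neq0 q_generic Hd (s := contz u d - contz u d.+1)) ?scaler0 //.
      exact: (opKt_weight q_neq0 (HT r) (word_vec_weight u)).
    by rewrite hw0; rewrite /contz; lia.
  - rewrite linear_sum big1 // => u /andP [lu _]; rewrite linearZ /=.
    by rewrite word_vec_maximal ?scaler0.
pose y := \sum_(u | lattice (r := r.+1) (k, u)) a u *: word_vec (r := r.+1) (k, u).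
rewrite -(subrK y x); apply: word_combD; last first.
  rewrite /y; elim/big_ind: _ => [|z z'|u lu]; [exact: word_comb0|exact: word_combD|].
  exact: word_comb_vec.
(* By triangularity y agrees with x along v_(k+1) and vanishes beyond, so d bounds the components of
   x - y. *)
have sy (l : 'I_n) : (k <= l)%N -> slice l y = (l == k)%:R *: slice k x.
  move=> kl; rewrite linear_sum xk scaler_sumr; apply: eq_bigr => u _.
  by rewrite linearZ /= (slice_word_vec (w := (k, u))) // !scalerA mulrC.
apply: IHd => [i Hi||l dl]; [|exact: ltnW|].
  rewrite linearB /= mx // linear_sum big1 ?subr0 // => u lu.
  by rewrite linearZ /= (word_vec_maximal lu) ?scaler0.
rewrite linearB /= sy //; case: eqP => [->|/eqP]; first by rewrite scale1r subrr.
rewrite -val_eqE /= => lk; rewrite scale0r subr0 x_ge //; lia.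
Qed.

Lemma memv_maximal_space r (x : based F (word n r)) :
  reflect (maximal x) (x \in maximal_space n (T r)).
Proof.
have -> : (x \in maximal_space n (T r)) = \big[andb/true]_(1 <= i < n) (x \in lker (opE (T r) i)).
  by apply: (big_morph (fun U : {vspace _} => x \in U)) => [U V|]; rewrite ?memv_cap ?memvf.
rewrite big_all; apply: (iffP allP) => mx i.
  by move=> Hi; apply/eqP; rewrite -memv_ker; apply: mx; rewrite mem_index_iota.
by rewrite mem_index_iota memv_ker => Hi; rewrite mx.
Qed.

Lemma free_image (I : finType) (A : pred I) (V : vectType F) (f : I -> V) :
  (forall a : I -> F, \sum_(i in A) a i *: f i = 0 -> forall i, i \in A -> a i = 0) ->
  free [seq f i | i in A].
Proof.
move=> f_free; apply/(@freeP _ _ _ [tuple of [seq f i | i in A]]) => c sum0 i.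
have Ai := enum_valP i.
have := f_free (fun j => c (enum_rank_in Ai j)) _ _ Ai; rewrite enum_valK_in; apply.
rewrite big_enum_val -[RHS]sum0; apply: eq_bigr => j _.
by rewrite enum_valK_in /= nth_image.
Qed.

Lemma word_vec_basis r :
  basis_of (maximal_space n (T r)) [seq word_vec w | w in @lattice n r].
Proof.
rewrite /basis_of eqEsubv -andbA; apply/and3P; split.
- by apply/span_subvP => _ /imageP [w lw ->]; apply/memv_maximal_space/word_vec_maximal.
- apply/subvP => x /memv_maximal_space/maximal_word_comb [a ->].
  by apply: memv_suml => w lw; apply/memvZ/memv_span/imageP; exists w.
- by apply: free_image => a; apply: word_vec_free.
Qed.

End WordVectors.

(** * Walks and lattice words *)

Lemma sumn_incr_nth v i : sumn (incr_nth v i) = (sumn v).+1.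
Proof.
elim: v i => [|a v IH] [|i] //=; last by rewrite IH addnS.
by elim: i => //= i ->.
Qed.

Lemma nth_le_sumn (v : seq nat) i : (nth 0%N v i <= sumn v)%N.
Proof.
elim: v i => [|a v IH] [|i] //=; first exact: leq_addr.
exact: leq_trans (IH i) (leq_addl _ _).
Qed.

(** [incr_nth mu] is injective, so k is the only position the search can find. *)
Lemma box_row_incr n mu (k : 'I_n) : box_row n mu (incr_nth mu k) = k.+1.
Proof.
rewrite /box_row (eq_find (a2 := pred1 (k : nat))) => [|l /=]; last first.
  by rewrite (inj_eq (@incr_nth_inj mu)) eq_sym.
congr _.+1; rewrite -[RHS](@index_uniq _ 0%N k (iota 0 n)) ?size_iota ?iota_uniq //.
by rewrite nth_iota.
Qed.

Section ShapesOfWords.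
Variables (n : nat) (d : 'I_n).
Implicit Types (p : nat -> seq nat).

(** The counterpart of [box_row] with values in ['I_n], the letters of words; d is returned only if
    nu does not arise from mu by adding a box. *)
Definition step_row (mu nu : seq nat) : 'I_n :=
  odflt d [pick k : 'I_n | nu == incr_nth mu k].

Fixpoint rows p (r : nat) : word n r :=
  match r return word n r with
  | 0 => tt
  | r'.+1 => (step_row (p r') (p r'.+1), rows p r')
  end.

(** Walks as functions on all naturals, without the bound on the parts, so that the type does not
    change in inductions on r. *)
Definition is_shape_walk p r :=
  (forall j, (j <= r)%N -> is_partition j (p j) && (size (p j) == n)) /\
  (forall j, (j < r)%N -> adds_box n (p j) (p j.+1)).

Lemma eq_rows p p' r : (forall j, (j <= r)%N -> p j = p' j) -> rows p r = rows p' r.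
Proof.
elim: r => // r IH eq_p; rewrite /= !eq_p //; congr pair.
by apply: IH => j jr; apply: eq_p; lia.
Qed.

Lemma step_rowE mu nu : adds_box n mu nu -> nu = incr_nth mu (step_row mu nu).
Proof.
move=> /existsP [k /eqP nuE]; rewrite /step_row; case: pickP => [l /eqP //|/(_ k)].
by rewrite nuE eqxx.
Qed.

Lemma is_shape_walkW p r : is_shape_walk p r.+1 -> is_shape_walk p r.
Proof. by move=> [part_p box_p]; split=> j jr; [apply: part_p|apply: box_p]; lia. Qed.

Lemma nth_shape p r i : is_shape_walk p r -> nth 0%N (p r) i = cont (rows p r) i.+1.
Proof.
elim: r => [|r IH] wp.
  have [/(_ 0%N isT) /andP [/andP [_ /eqP p0] _] _] := wp.
  by apply/eqP; have := nth_le_sumn (p 0%N) i; rewrite p0 leqn0.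
have box_p : adds_box n (p r) (p r.+1) by case: wp => _; apply.
rewrite {1}(step_rowE box_p) nth_incr_nth (IH (is_shape_walkW wp)) /=.
by rewrite eqSS addnC.
Qed.

Lemma lattice_rows p r : is_shape_walk p r -> lattice (rows p r).
Proof.
elim: r => // r IH wp; have wp' := is_shape_walkW wp.
rewrite /= IH //=; case: (posnP (step_row _ _)) => [->|k0] //.
have [/(_ r.+1 (leqnn _)) /andP [/andP [/(sortedP 0%N) sp _] /eqP size_p] _] := wp.
(* Weak decrease of the new shape at the row of the new box means that this row was strictly shorter
   than its predecessor before. *)
have := sp (step_row (p r) (p r.+1)).-1; rewrite size_p prednK // ltn_ord.
rewrite !(nth_shape _ wp) prednK //= => /(_ isT); rewrite eqxx /geq /=.
by case: eqP => [|_]; lia.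
Qed.

(** By [nth_shape] the word determines all parts, and the common size n rules out a difference in
    trailing zeros. *)
Lemma eq_rows_shape p p' r : is_shape_walk p r -> is_shape_walk p' r ->
  rows p r = rows p' r -> forall j, (j <= r)%N -> p j = p' j.
Proof.
elim: r => [|r IH] wp wp' eq_r j; last first.
  rewrite leq_eqVlt => /orP [/eqP ->|jr]; last first.
    by apply: IH => //; [apply: is_shape_walkW|apply: is_shape_walkW|case: eq_r].
  have [/(_ r.+1 (leqnn _)) /andP [_ /eqP sp] _] := wp.
  have [/(_ r.+1 (leqnn _)) /andP [_ /eqP sp'] _] := wp'.
  by apply: (@eq_from_nth _ 0%N) => [|i _]; rewrite ?sp ?sp' // !nth_shape // eq_r.
rewrite leqn0 => /eqP ->.
have [/(_ 0%N isT) /andP [_ /eqP sp] _] := wp.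
have [/(_ 0%N isT) /andP [_ /eqP sp'] _] := wp'.
by apply: (@eq_from_nth _ 0%N) => [|i _]; rewrite ?sp ?sp' // !nth_shape // eq_r.
Qed.

Lemma rows_surj r (w : word n r) : lattice w ->
  exists2 p, is_shape_walk p r & rows p r = w.
Proof.
elim: r w => [|r IH] w lw.
  exists (fun=> nseq n 0%N); last by case: w lw.
  split=> // j; rewrite leqn0 => /eqP ->.
  rewrite size_nseq eqxx andbT /is_partition sumn_nseq mul0n eqxx andbT.
  by apply/(sortedP 0%N) => i _; rewrite !nth_nseq !if_same.
case: w lw => k w lkw; have [p wp pw] := IH w (proj1 (andP lkw)).
pose p' j := if (j <= r)%N then p j else incr_nth (p r) k.
have p'E j : (j <= r)%N -> p' j = p j by rewrite /p' => ->.
have p'r : p' r.+1 = incr_nth (p r) k by rewrite /p' ltnn.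
have box_r : adds_box n (p' r) (p' r.+1) by apply/existsP; exists k; rewrite p'r (p'E r).
have p'w : rows p' r.+1 = (k, w).
  rewrite -pw -(eq_rows (p := p') p'E) /=; congr pair.
  apply: val_inj; apply: (@incr_nth_inj (p' r)).
  by rewrite -(step_rowE box_r) p'r p'E.
have [part_p box_p] := wp; exists p' => //.
have [/andP [_ /eqP sum_p] /eqP size_p] := andP (part_p r (leqnn r)).
split=> j; last first.
  rewrite ltnS leq_eqVlt => /orP [/eqP -> //|jr].
  by rewrite !p'E //; [apply: box_p|apply: ltnW].
rewrite leq_eqVlt => /orP [/eqP ->|jr].
- have size_p' : size (p' r.+1) = n by rewrite p'r size_incr_nth size_p ltn_ord.
  rewrite size_p' eqxx andbT /is_partition {2}p'r sumn_incr_nth sum_p eqxx andbT.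
  apply/(sortedP 0%N) => i _.
  have nthE l : nth 0%N (p' r.+1) l = cont (r := r.+1) (k, w) l.+1.
    by rewrite p'r nth_incr_nth nth_shape // pw /= addnC eqSS.
  by rewrite !nthE; apply: lattice_decr.
- by rewrite p'E //; apply: part_p.
Qed.

End ShapesOfWords.

Section WalkWords.
Variables (F : fieldType) (q : F) (n r : nat) (d : 'I_n).

Definition walk_word (pi : walk n r) : word n r := rows d (wshape (val pi)) r.

(** Lets [part] and [contz] be exchanged: they agree at positive indices but may differ at 0. *)
Lemma eq_Phi (J : finType) (M : uq_ops (based F J)) (lam lam' : nat -> int) m b :
  (forall i, (0 < i)%N -> lam i = lam' i) -> Phi q n M lam m b = Phi q n M lam' m b.
Proof.
move=> eq_lam; apply: eq_bigr => j _; congr (_ *: tens _ (fun_of_lfun _ _)).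
by apply: eq_Psi_shift => i Hi; apply: eq_lam; lia.
Qed.

Lemma shapes_vec_rows (p : nat -> seq nat) j : is_shape_walk n p j ->
  shapes_vec q n p j = word_vec q (rows d p j).
Proof.
elim: j => [|j IH] wp; first by rewrite /=; congr bvec.
have wp' := is_shape_walkW wp.
have box_p : adds_box n (p j) (p j.+1) by case: wp => _; apply.
rewrite /= -IH // {1}(step_rowE d box_p) box_row_incr.
apply: eq_Phi => i i0; rewrite /part /contz (nth_shape d) // prednK //.
Qed.

Lemma wshape_walk (pi : walk n r) : is_shape_walk n (wshape (val pi)) r.
Proof.
have /andP [/forallP part_p /forallP box_p] := valP pi.
split=> j jr; last exact: (box_p (Ordinal jr)).
rewrite (part_p (Ordinal (jr : (j < r.+1)%N))) /= /wshape.
pose s0 : n.-tuple 'I_r.+1 := [tuple ord0 | _ < n].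
rewrite (nth_map s0) ?size_tuple // size_map; apply/eqP/size_tuple.
Qed.

Lemma walk_vec_word (pi : walk n r) : walk_vec q pi = word_vec q (walk_word pi).
Proof. exact/shapes_vec_rows/wshape_walk. Qed.

Lemma walk_word_lattice (pi : walk n r) : lattice (walk_word pi).
Proof. exact/lattice_rows/wshape_walk. Qed.

Lemma walk_word_inj : injective walk_word.
Proof.
move=> pi pi' eq_w; apply: val_inj; apply: val_inj.
have eq_p := eq_rows_shape (wshape_walk pi) (wshape_walk pi') eq_w.
have inj : injective (fun s : n.-tuple 'I_r.+1 => [seq val x | x <- val s]).
  by move=> s s' /(inj_map val_inj)/val_inj.
apply: (inj_map inj); apply: (@eq_from_nth _ [::]); first by rewrite !size_map !size_tuple.
by move=> j; rewrite size_map size_tuple ltnS => /eq_p.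
Qed.

Lemma walk_word_surj (w : word n r) : lattice w -> exists pi, w = walk_word pi.
Proof.
move=> /(rows_surj d) [p wp <-].
(* Tabulates p; [inord] loses nothing, as a part of the j-th shape is at most j, hence at most r. *)
pose s : shape_seq n r := mktuple (fun j : 'I_r.+1 =>
  mktuple (fun i : 'I_n => inord (nth 0%N (p j) i) : 'I_r.+1)).
have [part_p box_p] := wp.
have sE j : (j <= r)%N -> wshape s j = p j.
  move=> jr; have [/andP [_ /eqP sum_p] /eqP size_p] := andP (part_p j jr).
  rewrite /wshape (nth_map [tuple ord0 | _ < n]) ?size_tuple //.
  rewrite -[j in nth _ _ j]/(val (Ordinal (jr : (j < r.+1)%N))) -tnth_nth tnth_mktuple.
  apply: (@eq_from_nth _ 0%N); first by rewrite size_map size_tuple.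
  move=> i; rewrite size_map size_tuple => i_n.
  rewrite (nth_map ord0) ?size_tuple //.
  rewrite -[i in nth _ _ i]/(val (Ordinal i_n)) -tnth_nth tnth_mktuple /= inordK //.
  by rewrite ltnS (leq_trans (nth_le_sumn _ _)) // sum_p.
have ws : is_walk s.
  apply/andP; split; apply/forallP => j.
    by rewrite sE -1?ltnS // ; case/andP: (part_p j (ltn_ord j)).
  by rewrite !sE ?box_p // ltnW.
by exists (exist _ s ws); apply: eq_rows => j jr; rewrite sE.
Qed.

End WalkWords.

Theorem corollary7p2 (F : fieldType) (q : F) (n r : nat)
    (q_neq0 : q != 0) (q_generic : not_root_of_unity q) (n_ge1 : (1 <= n)%N) :
  basis_of (maximal_space n (tpower q n r))
           [seq walk_vec q pi | pi : walk n r]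
  /\ (forall pi pi' : walk n r,
        pi != pi' -> bform (walk_vec q pi) (walk_vec q pi') = 0).
Proof.
pose d := Ordinal n_ge1; split; last first.
  move=> pi pi' ne; rewrite !(walk_vec_word _ d).
  by apply: word_vec_orthogonal; rewrite ?walk_word_lattice // (inj_eq (@walk_word_inj n r d)).
(* The bijection [walk_word] between walks and lattice words makes the two families permutations of
   each other. *)
rewrite -(perm_basis _ _ (X := [seq word_vec q w | w in @lattice n r])); last first.
  rewrite /image_mem [X in perm_eq _ X](eq_map (walk_vec_word q d)).
  rewrite (map_comp (@word_vec F q n r) (walk_word d)); apply: perm_map.
  apply: uniq_perm; rewrite ?enum_uniq ?(map_inj_uniq (@walk_word_inj n r d)) ?enum_uniq //.
  move=> w; rewrite mem_enum; apply/idP/mapP => [/(walk_word_surj d) [pi ->]|[pi _ ->]].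
    by exists pi; rewrite ?mem_enum.
  exact: walk_word_lattice.
exact: word_vec_basis.
Qed.
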